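(* Let $\mathcal I,\mathcal K$ be countable index sets, $T:\ell_2(\mathcal I)\to\ell_2(\mathcal K)$ a bounded linear operator with $\|T\|<1$, $g\in\ell_2(\mathcal K)$ and $r>0$. Suppose $1\le p\le 2$, where if $p=1$ it is assumed that $r\ge 1/4$. Starting from any $u^0$ satisfying $\mathcal J^p_r(u^0)<\infty$, the sequence $(u^n)_{n\in\mathbb N}$ defined by $u^{n+1}=\mathbb H(u^n)$ converges weakly to a vector $\bar u\in\ell_2(\mathcal I)$ that satisfies the following fixed point condition: 1. $|\bar u_i|\ge\lambda'(r,p)$, if $i\in\mathcal I_1=\{j\in\mathcal I:|\bar u_j|>r\}$; 2. for $p>1$: $|\bar u_i|\le F_p^{-1}(\lambda'(r,p))$, if $i\in\mathcal I_0=\{j\in\mathcal I:|\bar u_j|\le r\}$; 3. (a) if $p>1$: $$[T^*(g-T\bar u)]_i=\begin{cases}0,&\text{if }|\bar u_i|\ge\lambda'(r,p),\\ F_p(\bar u_i)-\bar u_i,&\text{if }|\bar u_i|\le\lambda'(r,p)-\delta(r,p);\end{cases}$$ (b) if $p=1$ and $r\ge 1/4$: $$\begin{cases}[T^*(g-T\bar u)]_i\in[-1/2,1/2],&|\bar u_i|\le 1/2,\\ [T^*(g-T\bar u)]_i=\tfrac12\operatorname{sgn}(\bar u_i),&1/2<|\bar u_i|\le r-1/4,\\ [T^*(g-T\bar u)]_i=0,&|\bar u_i|>r+1/4.\end{cases}$$ If the index set $\mathcal I$ is finite, the theorem holds for all $p\ge 1$.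
   Context: $\mathcal J^p_r(u)=\|Tu-g\|^2_{\ell_2(\mathcal K)}+\sum_{i\in\mathcal I}\min\{|u_i|^p,r^p\}$ for $u\in\ell_2(\mathcal I)$. For $p>1$: $F_p(t)=t+\frac p2\operatorname{sgn}(t)|t|^{p-1}$, with inverse function $F_p^{-1}$; $\lambda'=\lambda'(r,p)\in(r,r+\frac p2r^{p-1})$ is the unique positive value at which $(F_p^{-1}(\lambda')-\lambda')^2+|F_p^{-1}(\lambda')|^p=r^p$. The thresholding function is $H_{(p,r)}(\lambda)=F_p^{-1}(\lambda)$ if $|\lambda|\le\lambda'(r,p)$ and $H_{(p,r)}(\lambda)=\lambda$ if $|\lambda|>\lambda'(r,p)$. For $p=1$, $r\ge 1/4$: $\lambda'(r,1)=r+1/4$, and $H_{(1,r)}(\lambda)=0$ if $|\lambda|\le 1/2$, $H_{(1,r)}(\lambda)=(|\lambda|-1/2)\operatorname{sgn}(\lambda)$ if $1/2<|\lambda|\le r+1/4$, $H_{(1,r)}(\lambda)=\lambda$ if $|\lambda|>r+1/4$. $\delta(r,p)=|\lambda'(r,p)-H_{(p,r)}(\lambda'(r,p))|$ is the size of the jump of $H_{(p,r)}$ at $\lambda'(r,p)$. The map $\mathbb H:\ell_2(\mathcal I)\to\ell_2(\mathcal I)$ is defined by $[\mathbb H(u)]_i=H_{(p,r)}([u-T^*Tu+T^*g]_i)$, $i\in\mathcal I$. *)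

(* Defs.v *)
From HB Require Import structures.
From mathcomp Require Import all_boot all_order all_algebra.
From mathcomp Require Import all_classical all_reals all_analysis.
From mathcomp Require Import ring lra.

Set Implicit Arguments.
Unset Strict Implicit.
Unset Printing Implicit Defensive.

Import Order.TTheory GRing.Theory Num.Theory.
Import numFieldNormedType.Exports.

Local Open Scope classical_set_scope.
Local Open Scope ring_scope.

Section ell2_def.
Variables (R : realType) (I : countType).

Definition sqsum (u : I -> R) : \bar R := \esum_(i in [set: I]) (u i ^+ 2)%:E.

Definition sq_summable : {pred I -> R^o} :=
  fun u => `[< (sqsum u < +oo)%E >].

Lemma sq_summable_le (u v : I -> R^o) :
  (forall i, `|u i| <= `|v i|) -> v \in sq_summable -> u \in sq_summable.
Proof.
move=> uv /asboolP v2; apply/asboolP; apply: le_lt_trans v2.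
apply: le_esum => i _; rewrite lee_fin.
by rewrite -real_normK ?num_real// -[leRHS]real_normK ?num_real// lerXn2r ?nnegrE.
Qed.

Lemma sq_summable_submod_closed : submod_closed sq_summable.
Proof.
split=> [|a u v /asboolP u2 /asboolP v2]; apply/asboolP.
  by rewrite /sqsum esum1// => i _ /=; rewrite expr0n.
pose w i : R := (2 * a ^+ 2 * u i ^+ 2) + 2 * v i ^+ 2.
apply: (@le_lt_trans _ _ (\esum_(i in [set: I]) (w i)%:E)%E).
  apply: le_esum => i _; rewrite lee_fin /w.
  change ((a * u i + v i) ^+ 2 <= 2 * a ^+ 2 * u i ^+ 2 + 2 * v i ^+ 2).
  by have := sqr_ge0 (a * u i - v i); nra.
have sZ (c : R) (z : I -> R) : 0 <= c -> (sqsum z < +oo)%E ->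
    (\esum_(i in [set: I]) (c * z i ^+ 2)%:E < +oo)%E.
  move=> c0 z2; apply: (@le_lt_trans _ _ (c%:E * sqsum z)%E); last first.
    by rewrite lte_mul_pinfty.
  apply: ub_ereal_sup => _ [A fA <-].
  under eq_fsbigr do rewrite EFinM.
  rewrite -ge0_mule_fsumr; last by move=> i; rewrite lee_fin sqr_ge0.
  by apply: lee_wpmul2l => //; apply: ereal_sup_ubound; exists A.
under eq_esum do rewrite /w EFinD.
rewrite esumD; last 2 first.
- by move=> i _; rewrite lee_fin mulr_ge0 ?sqr_ge0// mulr_ge0 ?sqr_ge0.
- by move=> i _; rewrite lee_fin mulr_ge0 ?sqr_ge0.
by rewrite lte_add_pinfty// sZ// mulr_ge0 ?sqr_ge0.
Qed.

HB.instance Definition _ :=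
  GRing.isSubmodClosed.Build R (I -> R^o) sq_summable sq_summable_submod_closed.

Record ell2 := Ell2 { ell2_fun :> I -> R^o; _ : ell2_fun \in sq_summable }.

HB.instance Definition _ := [isSub for ell2_fun].
HB.instance Definition _ := [Choice of ell2 by <:].
HB.instance Definition _ := [SubChoice_isSubLmodule of ell2 by <:].

End ell2_def.

Section ell2_hilbert.
Variables (R : realType) (I : countType).
Implicit Types u v : ell2 R I.

(* The unconditional sum of an absolutely summable real family; [esum] itself
   is only meaningful for nonnegative terms. *)
Definition rsum (f : I -> R) : R :=
  fine (\esum_(i in [set: I]) (f^\+ i)%:E)
  - fine (\esum_(i in [set: I]) (f^\- i)%:E).

Definition dotl2 u v : R := rsum (fun i => u i * v i).

Definition norml2 u : R := Num.sqrt (dotl2 u u).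

Definition weak_cvg (w : nat -> ell2 R I) u : Prop :=
  forall v, (fun n => dotl2 (w n) v) @ \oo --> dotl2 u v.

End ell2_hilbert.

Section operators.
Variables (R : realType) (I K : countType).
Implicit Type T : {linear ell2 R I -> ell2 R K}.

(* Extended-real valued: [opnorm T = +oo] iff T is unbounded, so that
   [opnorm T < 1] includes the boundedness of T. *)
Definition opnorm T : \bar R :=
  ereal_sup [set (norml2 (T u))%:E | u in [set u | norml2 u <= 1]].

(* The Hilbert adjoint: [adjoint T v] is the vector w, unique if it exists,
   with <Tu, v> = <u, w> for all u. *)
Definition adjoint T (v : ell2 R K) : ell2 R I :=
  xget 0 [set w | forall u, dotl2 (T u) v = dotl2 u w].

End operators.

Section thresholding.
Variable R : realType.
Implicit Types p r t l : R.

Definition Fp p t : R := t + p / 2 * Num.sg t * `|t| `^ (p - 1).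

(* Inverse function of [Fp p], which is a bijection of R for p > 1. *)
Definition Fpinv p l : R := xget 0 [set t | Fp p t = l].

Definition lambda' r p : R :=
  if p == 1 then r + 1 / 4 else
  xget 0 [set l | r < l < r + p / 2 * r `^ (p - 1) /\
                  (Fpinv p l - l) ^+ 2 + `|Fpinv p l| `^ p = r `^ p].

Definition Hthr p r l : R :=
  if p == 1 then
    if `|l| <= 1 / 2 then 0
    else if `|l| <= r + 1 / 4 then (`|l| - 1 / 2) * Num.sg l
    else l
  else if `|l| <= lambda' r p then Fpinv p l else l.

Definition jump r p : R := `|lambda' r p - Hthr p r (lambda' r p)|.

Lemma norm_Fpinv_le p l : 1 <= p -> `|Fpinv p l| <= `|l|.
Proof.
move=> p1; rewrite /Fpinv; case: xgetP => [t _ /= <-|_]; last by rewrite normr0.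
have [->|t0] := eqVneq t 0; first by rewrite normr0.
rewrite /Fp {2}[t]numEsg -mulrA [_ * (Num.sg t * _)]mulrCA -mulrDr normrM.
rewrite normr_sg t0 mul1r; apply: le_trans (ler_norm _).
by rewrite lerDl mulr_ge0 ?powR_ge0// divr_ge0// (le_trans ler01).
Qed.

Lemma norm_Hthr_le p r l : 1 <= p -> `|Hthr p r l| <= `|l|.
Proof.
move=> p1; rewrite /Hthr; case: eqP => _.
  case: ifPn => [_|]; first by rewrite normr0.
  rewrite -ltNge => l2; case: ifP => // _.
  rewrite normrM normr_sg ger0_norm; last by lra.
  by case: (l != 0) => /=; rewrite ?mulr1 ?mulr0//; lra.
by case: ifP => // _; exact: norm_Fpinv_le.
Qed.

End thresholding.

Section algorithm.
Variables (R : realType) (I K : countType).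
Variables (p r : R) (T : {linear ell2 R I -> ell2 R K}) (g : ell2 R K).

Definition Jpr (u : ell2 R I) : \bar R :=
  ((norml2 (T u - g) ^+ 2)%:E
   + \esum_(i in [set: I]) (Num.min (`|u i| `^ p) (r `^ p))%:E)%E.

Definition landweber (u : ell2 R I) : ell2 R I :=
  u - adjoint T (T u) + adjoint T g.

Hypothesis p1 : 1 <= p.

Lemma Hmap_subproof (u : ell2 R I) :
  (fun i => Hthr p r (landweber u i)) \in @sq_summable R I.
Proof.
apply: (@sq_summable_le _ _ _ (landweber u)); last exact: valP.
by move=> i; exact: norm_Hthr_le.
Qed.

Definition Hmap (u : ell2 R I) : ell2 R I := Ell2 (Hmap_subproof u).

End algorithm.

(* Main.v *)
Require Import Defs.
From HB Require Import structures.
From mathcomp Require Import all_boot all_order all_algebra.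
From mathcomp Require Import all_classical all_reals all_analysis.
From mathcomp Require Import ring lra.

Set Implicit Arguments.
Unset Strict Implicit.
Unset Printing Implicit Defensive.

Import Order.TTheory GRing.Theory Num.Theory.
Import numFieldNormedType.Exports.

Local Open Scope classical_set_scope.
Local Open Scope ring_scope.

(** One step of the iteration minimises, coordinate by coordinate, the surrogate
    [J u + |u - v|^2 - |T (u - v)|^2], so [J] decreases by at least
    [(1 - |T|^2) |u^(n+1) - u^n|^2] and successive iterates get arbitrarily
    close. As the values of the thresholding function avoid the gap between
    [Fp^-1 lambda'] and [lambda'] (between [r - 1/4] and [r + 1/4] for [p = 1]),
    the set of large coordinates, which is finite, is eventually constant. From
    then on [u^(n+1)] is a proximal step for a convex functional in the metric
    [|u|^2 - |T u|^2]: the distance to every stationary point decreases.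

    The orbit is bounded: its small coordinates are controlled by [J], and on
    the finite set of large coordinates the iterates only move orthogonally to
    the kernel of [T], where [T] is bounded below. Hence weak limits along
    ultrafilters exist, they are stationary because the subgradient graphs are
    closed and [T] is weakly continuous, and Opial's argument shows that they
    all coincide. *)

(** * Sums of real families and the Hilbert space structure *)

Section real_sums.
Variables (R : realType) (I : countType).
Implicit Types f g : I -> R.

Definition rsummable f : Prop := summable [set: I] (EFin \o f).

Lemma le_esum_seq f (s : seq I) : uniq s ->
  ((\sum_(i <- s) f i)%:E <= \esum_(i in [set: I]) (f i)%:E)%E.
Proof.
move=> us; apply: esum_ge; exists [set` s].
  by split=> //; exact: finite_seq.
by rewrite -fsbig_seq// sumEFin.
Qed.

Lemma esum_le_seq f (M : R) :
  (forall s : seq I, uniq s -> \sum_(i <- s) f i <= M) ->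
  (\esum_(i in [set: I]) (f i)%:E <= M%:E)%E.
Proof.
move=> fM; apply: ge_ereal_sup => _ [A [finA _] <-].
by rewrite fsbig_finite// sumEFin lee_fin fM// finmap.fset_uniq.
Qed.

Lemma rsummable_le f g : (forall i, `|f i| <= g i) -> rsummable g -> rsummable f.
Proof.
move=> fg; apply: le_lt_trans; apply: le_esum => i _ /=.
by rewrite lee_fin (le_trans (fg i))// ler_norm.
Qed.

Lemma rsummable_norm f : rsummable f -> rsummable (fun i => `|f i|).
Proof. by apply: le_lt_trans; apply: le_esum => i _ /=; rewrite normr_id. Qed.

Lemma rsummableD f g :
  rsummable f -> rsummable g -> rsummable (fun i => f i + g i).
Proof. exact: summableD. Qed.

Lemma rsummable_ge0P f : (forall i, 0 <= f i) ->
  rsummable f <-> (\esum_(i in [set: I]) (f i)%:E < +oo)%E.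
Proof.
move=> f0; rewrite /rsummable /summable.
suff -> : \esum_(x in [set: I]) `|(EFin \o f) x|%E = \esum_(i in [set: I]) (f i)%:E
  by [].
by apply: eq_esum => i _ /=; rewrite ger0_norm.
Qed.

Lemma esum_fin_num f : (forall i, 0 <= f i) -> rsummable f ->
  \esum_(i in [set: I]) (f i)%:E \is a fin_num.
Proof.
move=> f0 /rsummable_ge0P fs; rewrite ge0_fin_numE; first exact: fs.
by apply: esum_ge0 => i _; rewrite lee_fin.
Qed.

Lemma rsummable_pos f : rsummable f -> rsummable f^\+.
Proof.
move=> /rsummable_norm; apply: rsummable_le => i.
rewrite ger0_norm ?funrpos_ge0//.
by rewrite -[leRHS]/((Num.norm \o f) i) -funrposDneg lerDl funrneg_ge0.
Qed.

Lemma rsummable_neg f : rsummable f -> rsummable f^\-.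
Proof.
move=> /rsummable_norm; apply: rsummable_le => i.
rewrite ger0_norm ?funrneg_ge0//.
by rewrite -[leRHS]/((Num.norm \o f) i) -funrposDneg lerDr funrpos_ge0.
Qed.

(** This frees [rsum] from the canonical positive and negative parts. Additivity needs it, because
    [f^\+ + g^\+] is in general not the positive part of [f + g]. *)
Lemma rsumBge0 f g : rsummable f -> rsummable g ->
  (forall i, 0 <= f i) -> (forall i, 0 <= g i) ->
  rsum (fun i => f i - g i) = fine (\esum_(i in [set: I]) (f i)%:E)
                              - fine (\esum_(i in [set: I]) (g i)%:E).
Proof.
move=> sf sg f0 g0.
have sfg : rsummable (fun i => f i - g i) := summableB sf sg.
have := @esumB R I setT _ _ sf sg (fun i _ => f0 i) (fun i _ => g0 i).
have -> : (fun x => (EFin \o f) x - (EFin \o g) x)%E = EFin \o (fun i => f i - g i).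
  by apply/funext => i.
rewrite funerpos funerneg /= => /(congr1 fine).
rewrite !fineB ?esum_fin_num//.
- exact: (rsummable_pos sfg).
- exact: (rsummable_neg sfg).
Qed.

Lemma rsum_ge0E f : (forall i, 0 <= f i) ->
  rsum f = fine (\esum_(i in [set: I]) (f i)%:E).
Proof.
move=> f0; rewrite /rsum.
have -> : f^\+ = f by apply/funext => i; apply: (@ge0_funrposE _ _ setT); rewrite ?inE.
have -> : f^\- = cst 0 by apply/funext => i; apply: (@ge0_funrnegE _ _ setT); rewrite ?inE.
by rewrite [X in _ - fine X]esum1 ?subr0.
Qed.

Lemma rsum_ge0 f : (forall i, 0 <= f i) -> 0 <= rsum f.
Proof.
by move=> f0; rewrite rsum_ge0E// fine_ge0// esum_ge0// => i _; rewrite lee_fin.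
Qed.

Lemma esum_rsum f : (forall i, 0 <= f i) -> rsummable f ->
  \esum_(i in [set: I]) (f i)%:E = (rsum f)%:E.
Proof. by move=> f0 fs; rewrite rsum_ge0E// fineK// esum_fin_num. Qed.

Lemma rsumD f g : rsummable f -> rsummable g ->
  rsum (fun i => f i + g i) = rsum f + rsum g.
Proof.
move=> sf sg.
have -> : (fun i => f i + g i) = (fun i => (f^\+ i + g^\+ i) - (f^\- i + g^\- i)).
  by apply/funext => i; rewrite -[LHS]/((f + g) i) -funrDB.
have pf := rsummable_pos sf; have nf := rsummable_neg sf.
have pg := rsummable_pos sg; have ng := rsummable_neg sg.
have f1 := @funrpos_ge0 _ _ f; have f2 := @funrneg_ge0 _ _ f.
have g1 := @funrpos_ge0 _ _ g; have g2 := @funrneg_ge0 _ _ g.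
rewrite rsumBge0; do ?[exact: rsummableD|by move=> i; rewrite addr_ge0].
under eq_esum do rewrite EFinD.
rewrite esumD; do ?[by move=> i _; rewrite lee_fin].
under [X in _ - fine X]eq_esum do rewrite EFinD.
rewrite esumD; do ?[by move=> i _; rewrite lee_fin].
rewrite !fineD ?esum_fin_num// /rsum.
by ring.
Qed.

Lemma esumZ f (c : R) : 0 <= c -> (forall i, 0 <= f i) -> rsummable f ->
  (\esum_(i in [set: I]) (c * f i)%:E = c%:E * \esum_(i in [set: I]) (f i)%:E)%E.
Proof.
(* Only one inequality is proved directly; the reverse one is the same bound for the scaled family
   and the factor [c^-1]. *)
have le (k : R) (h : I -> R) : 0 <= k -> (forall i, 0 <= h i) -> rsummable h ->
    (\esum_(i in [set: I]) (k * h i)%:E <= k%:E * \esum_(i in [set: I]) (h i)%:E)%E.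
  move=> k0 h0 sh; rewrite [X in (_ <= _ * X)%E]esum_rsum// -EFinM; apply: esum_le_seq => s us.
  rewrite -mulr_sumr ler_wpM2l// -lee_fin -esum_rsum//; exact: le_esum_seq.
move=> c0 f0 sf; have [->|cn0] := eqVneq c 0.
  by rewrite mul0e esum1// => i _; rewrite mul0r.
have cp : 0 < c by rewrite lt_neqAle eq_sym cn0.
have h0 i : 0 <= c * f i by rewrite mulr_ge0.
have sh : rsummable (fun i => c * f i).
  apply/rsummable_ge0P => //; apply: le_lt_trans (le _ _ c0 f0 sf) _.
  by rewrite esum_rsum// -EFinM ltry.
apply/eqP; rewrite eq_le le//=.
have ci0 : 0 <= c^-1 by rewrite invr_ge0.
have := le _ _ ci0 h0 sh.
under [X in (X <= _)%E]eq_esum do rewrite mulKf//.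
by rewrite !esum_rsum// -!EFinM !lee_fin ler_pdivlMl.
Qed.

Lemma rsumZ f (c : R) : rsummable f -> rsum (fun i => c * f i) = c * rsum f.
Proof.
move=> sf; have pf := rsummable_pos sf; have nf := rsummable_neg sf.
have f1 := @funrpos_ge0 _ _ f; have f2 := @funrneg_ge0 _ _ f.
rewrite /rsum; have [c0|c0] := leP 0 c.
  rewrite ge0_funrposM// ge0_funrnegM//= !esumZ//.
  by rewrite !fineM ?esum_fin_num// mulrBr.
have Nc0 : 0 <= - c by rewrite oppr_ge0 ltW.
rewrite le0_funrposM ?(ltW c0)// le0_funrnegM ?(ltW c0)//= !esumZ//.
by rewrite !fineM ?esum_fin_num//=; ring.
Qed.

Lemma rsummableZ f (c : R) : rsummable f -> rsummable (fun i => c * f i).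
Proof.
move=> /rsummable_norm sf.
apply: (@rsummable_le _ (fun i => `|c| * `|f i|)); first by move=> i; rewrite normrM.
apply/rsummable_ge0P => [i|]; first by rewrite mulr_ge0.
by rewrite esumZ// esum_rsum// -EFinM ltry.
Qed.

Lemma ler_rsum f g : rsummable f -> rsummable g -> (forall i, f i <= g i) ->
  rsum f <= rsum g.
Proof.
move=> sf sg fg.
have sN : rsummable (fun i => -1 * f i) by exact: rsummableZ.
have : 0 <= rsum (fun i => g i + -1 * f i).
  by apply: rsum_ge0 => i; have := fg i; lra.
by rewrite rsumD// rsumZ//; lra.
Qed.

Lemma ler_sum_rsum f (s : seq I) : (forall i, 0 <= f i) -> rsummable f -> uniq s ->
  \sum_(i <- s) f i <= rsum f.
Proof. by move=> f0 sf us; rewrite -lee_fin -esum_rsum//; exact: le_esum_seq. Qed.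

Lemma rsum_approx f (e : R) : (forall i, 0 <= f i) -> rsummable f -> 0 < e ->
  exists2 s : seq I, uniq s & rsum f - e < \sum_(i <- s) f i.
Proof.
move=> f0 sf e0; apply: contrapT => H.
suff : (\esum_(i in [set: I]) (f i)%:E <= (rsum f - e)%:E)%E.
  by rewrite esum_rsum// lee_fin; lra.
apply: esum_le_seq => s us; rewrite leNgt; apply/negP => ls; apply: H.
by exists s.
Qed.

End real_sums.

(** * The inner product of [ell2] and criteria for square summability *)

Section ell2_theory.
Variables (R : realType) (I : countType).
Implicit Types u v w : ell2 R I.

Lemma ell2P u v : (forall i, u i = v i) -> u = v.
Proof. by move=> uv; apply: val_inj; apply/funext. Qed.

Lemma ell2D u v i : (u + v) i = u i + v i. Proof. by []. Qed.
Lemma ell2N u i : (- u) i = - u i. Proof. by []. Qed.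
Lemma ell2B u v i : (u - v) i = u i - v i. Proof. by []. Qed.
Lemma ell2Z (c : R) u i : (c *: u) i = c * u i. Proof. by []. Qed.
Lemma ell20 i : (0 : ell2 R I) i = 0. Proof. by []. Qed.

Lemma ell2_sum (T : Type) (s : seq T) (F : T -> ell2 R I) i :
  (\sum_(j <- s) F j) i = \sum_(j <- s) F j i.
Proof.
by elim: s => [|j s ih]; rewrite ?big_nil ?big_cons ?ell2D ?ih.
Qed.

Lemma ell2_sq_summable u : rsummable (fun i => u i ^+ 2).
Proof.
apply/rsummable_ge0P => [i|]; first exact: sqr_ge0.
by have /asboolP := valP u.
Qed.

Lemma dot_summable u v : rsummable (fun i => u i * v i).
Proof.
apply: (@rsummable_le _ _ _ (fun i => u i ^+ 2 + v i ^+ 2)); last first.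
  by apply: rsummableD; exact: ell2_sq_summable.
move=> i; rewrite ler_norml; apply/andP; split.
  by have := sqr_ge0 (u i + v i); have := sqr_ge0 (u i); have := sqr_ge0 (v i); nra.
by have := sqr_ge0 (u i - v i); have := sqr_ge0 (u i); have := sqr_ge0 (v i); nra.
Qed.

Lemma dotC u v : dotl2 u v = dotl2 v u.
Proof. by rewrite /dotl2; congr rsum; apply/funext => i; rewrite mulrC. Qed.

Lemma dotDl u v w : dotl2 (u + v) w = dotl2 u w + dotl2 v w.
Proof.
rewrite /dotl2 -rsumD; do ?exact: dot_summable.
by congr rsum; apply/funext => i; rewrite ell2D mulrDl.
Qed.

Lemma dotZl (c : R) u w : dotl2 (c *: u) w = c * dotl2 u w.
Proof.
rewrite /dotl2 -rsumZ; last exact: dot_summable.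
by congr rsum; apply/funext => i; rewrite ell2Z mulrA.
Qed.

Lemma dotNl u w : dotl2 (- u) w = - dotl2 u w.
Proof. by rewrite -scaleN1r dotZl mulN1r. Qed.

Lemma dotBl u v w : dotl2 (u - v) w = dotl2 u w - dotl2 v w.
Proof. by rewrite dotDl dotNl. Qed.

Lemma dotDr u v w : dotl2 w (u + v) = dotl2 w u + dotl2 w v.
Proof. by rewrite dotC dotDl !(dotC w). Qed.

Lemma dotZr (c : R) u w : dotl2 w (c *: u) = c * dotl2 w u.
Proof. by rewrite dotC dotZl (dotC w). Qed.

Lemma dotNr u w : dotl2 w (- u) = - dotl2 w u.
Proof. by rewrite dotC dotNl (dotC w). Qed.

Lemma dotBr u v w : dotl2 w (u - v) = dotl2 w u - dotl2 w v.
Proof. by rewrite dotDr dotNr. Qed.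

Lemma dot0l w : dotl2 0 w = 0.
Proof. by rewrite -(scale0r 0) dotZl mul0r. Qed.

Lemma dot0r w : dotl2 w 0 = 0.
Proof. by rewrite dotC dot0l. Qed.

Lemma dot_ge0 u v : (forall i, 0 <= u i * v i) -> 0 <= dotl2 u v.
Proof. by move=> uv; exact: rsum_ge0. Qed.

Lemma dotuu_ge0 u : 0 <= dotl2 u u.
Proof. by apply: dot_ge0 => i; rewrite -expr2 sqr_ge0. Qed.

Lemma sum_sq_le_dot u (s : seq I) : uniq s -> \sum_(i <- s) u i ^+ 2 <= dotl2 u u.
Proof.
move=> us; rewrite /dotl2; under eq_bigr do rewrite expr2.
apply: ler_sum_rsum => //; last exact: dot_summable.
by move=> i; rewrite -expr2 sqr_ge0.
Qed.

Lemma sq_le_dot u i : u i ^+ 2 <= dotl2 u u.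
Proof. by have := @sum_sq_le_dot u [:: i] isT; rewrite big_seq1. Qed.

Lemma dotuu_eq0 u : dotl2 u u <= 0 -> u = 0.
Proof.
move=> u0; apply: ell2P => i; rewrite ell20.
have := le_trans (sq_le_dot u i) u0; have := sqr_ge0 (u i) => h1 h2.
by apply/eqP; rewrite -sqrf_eq0 eq_le h1 h2.
Qed.

Lemma dot_CS u v : dotl2 u v ^+ 2 <= dotl2 u u * dotl2 v v.
Proof.
have [v0|v0] := leP (dotl2 v v) 0.
  by rewrite (dotuu_eq0 v0) !dot0r expr0n mulr0.
(* With [a], [b], [c] as set below, this squared norm equals [c * (a * c - b ^+ 2)], and [c > 0] can
   be cancelled. *)
have := dotuu_ge0 (dotl2 v v *: u - dotl2 u v *: v).
rewrite !(dotBl, dotBr, dotZl, dotZr) (dotC v u).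
set a := dotl2 u u; set b := dotl2 u v; set c := dotl2 v v => h.
have : 0 <= c * (a * c - b ^+ 2).
  by apply: le_trans h _; rewrite le_eqVlt; apply/orP; left; apply/eqP; ring.
by rewrite pmulr_rge0// subr_ge0.
Qed.

Lemma norml2_sq u : norml2 u ^+ 2 = dotl2 u u.
Proof. by rewrite /norml2 sqr_sqrtr// dotuu_ge0. Qed.

Lemma sq_dotB_le u v : dotl2 (u - v) (u - v) <= 2 * dotl2 u u + 2 * dotl2 v v.
Proof.
have := dotuu_ge0 (u + v).
by rewrite !(dotBl, dotBr, dotDl, dotDr) (dotC v u); lra.
Qed.

Lemma sq_summable_bounded (f : I -> R^o) (M : R) :
  (forall s : seq I, uniq s -> \sum_(i <- s) f i ^+ 2 <= M) ->
  f \in sq_summable (R := R) (I := I).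
Proof.
move=> fM; apply/asboolP; apply: le_lt_trans (ltry M).
exact: (@esum_le_seq R I (fun i => f i ^+ 2)).
Qed.

Lemma basis_subproof (i : I) :
  (fun j => (j == i)%:R : R^o) \in sq_summable (R := R) (I := I).
Proof.
apply: (@sq_summable_bounded _ 1) => s us.
have [si|si] := boolP (i \in s).
  rewrite (bigD1_seq i)//= eqxx expr1n big1 ?addr0// => j /negbTE ->.
  by rewrite expr0n.
rewrite big1_seq// => j /= js; rewrite (_ : j == i = false) ?expr0n//.
by apply: contraNF si => /eqP <-.
Qed.

End ell2_theory.

(** * Riesz representation, ultrafilter limits and adjoints *)

Section ell2_basis.
Variables (R : realType) (I : countType).
Implicit Types (u v w : ell2 R I) (f : I -> R).

Definition basis (i : I) : ell2 R I := Ell2 (basis_subproof R i).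

Lemma dot_basis u i : dotl2 u (basis i) = u i.
Proof.
rewrite /dotl2 (_ : (fun j => u j * basis i j) = (fun j => u i * basis i j)); last first.
  by apply/funext => j /=; have [->|_] := eqVneq j i; rewrite ?mulr0.
have e0 j : 0 <= basis i j by rewrite /= ler0n.
have e1 : \esum_(j in [set: I]) (basis i j)%:E = 1%E.
  rewrite -[RHS](@esum_set1 R I i (fun=> 1%E))// [RHS]esum_mkcond.
  apply: eq_esum => j _ /=.
  have [->|ji] := eqVneq j i; first by rewrite mem_set.
  by rewrite memNset//; exact/eqP.
have es : rsummable (basis i) by apply/rsummable_ge0P => //; rewrite e1 ltry.
by rewrite rsumZ// rsum_ge0E// e1 /= mulr1.
Qed.

(** The family [f] is arbitrary because [riesz] uses coefficients that are not yet known to be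
    square summable. *)
Definition fproj (s : seq I) f : ell2 R I := \sum_(i <- s) f i *: basis i.

Lemma dot_fproj s u f : dotl2 u (fproj s f) = \sum_(i <- s) u i * f i.
Proof.
rewrite /fproj; elim: s => [|i s ih]; first by rewrite !big_nil dot0r.
by rewrite !big_cons dotDr dotZr dot_basis ih mulrC.
Qed.

Lemma fprojE s f i : uniq s -> i \in s -> fproj s f i = f i.
Proof.
move=> us si; rewrite /fproj ell2_sum (bigD1_seq i)// big1; last first.
  by move=> j /negbTE; rewrite eq_sym => ij; rewrite ell2Z /= ij mulr0.
by rewrite Monoid.mulm1 ell2Z /= eqxx mulr1.
Qed.

Lemma dot_fproj_fproj s f : uniq s ->
  dotl2 (fproj s f) (fproj s f) = \sum_(i <- s) f i ^+ 2.
Proof.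
move=> us; rewrite dot_fproj; apply: eq_big_seq => i si.
by rewrite fprojE// expr2.
Qed.

Lemma fproj_approx v (e : R) : 0 < e ->
  exists2 s, uniq s & dotl2 (v - fproj s v) (v - fproj s v) < e.
Proof.
move=> e0; have f0 i : 0 <= v i * v i by rewrite -expr2 sqr_ge0.
have [s us hs] := rsum_approx f0 (dot_summable v v) e0.
exists s => //; rewrite !(dotBl, dotBr) dot_fproj_fproj// (dotC (fproj s v)) dot_fproj.
under [X in _ - (_ - X)]eq_bigr do rewrite expr2.
by move: hs; rewrite -/(dotl2 v v); lra.
Qed.

(** The representing vector has coordinates [L (basis i)]. Testing the bound on [fproj s f] gives
    [S ^+ 2 <= M * S] for each partial sum [S] of squares, hence [S <= M]; agreement on finitely
    supported vectors then extends by approximation. *)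
Lemma riesz (L : ell2 R I -> R) (M : R) : 0 <= M ->
  (forall u v, L (u + v) = L u + L v) ->
  (forall c u, L (c *: u) = c * L u) ->
  (forall u, L u ^+ 2 <= M * dotl2 u u) ->
  exists w, forall u, L u = dotl2 w u.
Proof.
move=> M0 LD LZ LM.
have L0 : L 0 = 0 by rewrite -(scale0r 0) LZ mul0r.
have LN x : L (- x) = - L x by rewrite -scaleN1r LZ mulN1r.
have LP s f : L (fproj s f) = \sum_(i <- s) f i * L (basis i).
  rewrite /fproj; elim: s => [|i s ih]; first by rewrite !big_nil.
  by rewrite !big_cons LD LZ ih.
pose f i := L (basis i).
have wM (s : seq I) : uniq s -> \sum_(i <- s) f i ^+ 2 <= M.
  move=> us; have := LM (fproj s f); rewrite LP dot_fproj_fproj//.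
  under eq_bigr do rewrite -expr2.
  set S := \sum_(i <- s) _.
  have [S0 _|S0] := leP S 0; first exact: le_trans M0.
  by rewrite expr2 ler_pM2r.
pose w : ell2 R I := Ell2 (@sq_summable_bounded _ _ f M wM).
exists w => u; apply/eqP; rewrite -subr_eq0 -sqrf_eq0 eq_le sqr_ge0 andbT.
have D s : L u - dotl2 w u = L (u - fproj s u) - dotl2 w (u - fproj s u).
  rewrite LD LN LP dotBr dot_fproj.
  under [X in _ = _ - (_ - X)]eq_bigr do rewrite mulrC.
  by rewrite /=; ring.
apply/ler_addgt0Pl => e e0; rewrite addr0.
(* The squared discrepancy at [z] is at most [2 * (M + dotl2 w w) * dotl2 z z]; the added 1 keeps
   the divisor positive. *)
have C0 : 0 < 2 * (M + dotl2 w w) + 1 by have := dotuu_ge0 w; lra.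
have [s us hs] := fproj_approx u (divr_gt0 e0 C0).
rewrite (D s); move: hs; set z := u - fproj s u => hz.
have h1 := LM z; have h2 := dot_CS w z; have h3 := dotuu_ge0 w; have h4 := dotuu_ge0 z.
move: hz; rewrite ltr_pdivlMr// => hz.
set a := L z in h1 *; set b := dotl2 w z in h2 *.
have := sqr_ge0 (a + b); nra.
Qed.

End ell2_basis.

(** * Limits along ultrafilters, for real sequences and weakly in [ell2] *)

Section ultrafilter_limits.
Variable R : realType.
Implicit Types (W : set_system nat) (a : nat -> R).

(** Compactness of the segment gives a cluster point, and for an ultrafilter a cluster point is a
    limit. *)
Lemma bounded_ultra_cvg W a (M : R) : UltraFilter W ->
  (forall n, `|a n| <= M) -> exists l : R, a n @[n --> W] --> l.
Proof.
move=> UW aM.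
have [l [_ cl]] : `[- M, M]%classic `&` cluster (a @ W) !=set0.
  have h : W (a @^-1` `[- M, M]%classic).
    by apply: filterS filterT => n _ /=; rewrite in_itv /= -ler_norml.
  exact: segment_compact h.
exists l => V lV; have [//|WV] := in_ultra_setVsetC (a @^-1` V) UW.
by have [y [/= nVy Vy]] := cl (~` V) V WV lV.
Qed.

(** If convergence fails for some [e], the trace of [\oo] on the bad indices is a proper filter; an
    ultrafilter extending it contradicts the hypothesis. *)
Lemma ultra_cvg a (l : R) :
  (forall W, UltraFilter W -> \oo `<=` W -> a n @[n --> W] --> l) ->
  a n @[n --> \oo] --> l.
Proof.
move=> H; apply/cvgrPdist_lt => e e0; apply: contrapT => nA.
pose A := [set n | `|l - a n| < e].
have PF : ProperFilter (within (~` A) \oo).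
  apply: Build_ProperFilter; rewrite /within /= => h.
  apply: nA; apply: filterS h => n h; apply: contrapT => h'; exact: h.
have [W [UW sW]] := ultraFilterLemma PF.
have ooW : \oo `<=` W by move=> B oB; apply: sW; apply: filterS oB => n.
have /cvgrPdist_lt /(_ _ e0) WA := H W UW ooW.
have WnA : W (~` A) by apply: sW; exact: (@nearW _ \oo).
have : W set0 by apply: filterS (filterI WA WnA) => n [].
exact: filter_not_empty.
Qed.

Lemma cvgR_unique (T : Type) (F : set_system T) {PF : ProperFilter F}
    (a : T -> R) (l l' : R) :
  a n @[n --> F] --> l -> a n @[n --> F] --> l' -> l = l'.
Proof. by move=> h h'; exact: (@cvg_unique R^o (@norm_hausdorff _ _) _ _ _ _ h h'). Qed.

(** Weak compactness of balls: the limits of the inner products along [W] form a bounded linear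
    form, which [riesz] represents. Fixing an ultrafilter takes the place of a diagonal
    extraction. *)
Lemma weak_ultra_lim (I : countType) W (u : nat -> ell2 R I) (M : R) : UltraFilter W ->
  (forall n, dotl2 (u n) (u n) <= M) ->
  exists w, forall v, dotl2 (u n) v @[n --> W] --> dotl2 w v.
Proof.
move=> UW uM.
have M0 : 0 <= M by exact: le_trans (dotuu_ge0 (u 0%N)) (uM 0%N).
have bd v n : dotl2 (u n) v ^+ 2 <= M * dotl2 v v.
  by apply: le_trans (dot_CS _ _) _; rewrite ler_wpM2r// dotuu_ge0.
have /choice[L LP] : forall v, exists l : R, dotl2 (u n) v @[n --> W] --> l.
  move=> v; apply: (@bounded_ultra_cvg _ _ (Num.sqrt (M * dotl2 v v))) => // n.
  by rewrite -sqrtr_sqr ler_wsqrtr.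
have [w wP] : exists w, forall v, L v = dotl2 w v.
  apply: (@riesz _ _ _ M) => //.
  - move=> x y; apply: (cvgR_unique (LP (x + y))).
    under eq_fun do rewrite dotDr.
    exact: cvgD.
  - move=> c x; apply: (cvgR_unique (LP (c *: x))).
    under eq_fun do rewrite dotZr.
    exact: cvgMr.
  - move=> x; apply: (@cvgr_to_le _ W _ _ (fun n => dotl2 (u n) x * dotl2 (u n) x)).
      by rewrite expr2; apply: cvgM.
    by apply: filterS filterT => n _; rewrite -expr2.
by exists w => v; rewrite -wP.
Qed.

End ultrafilter_limits.

Section bounded_operators.
Variables (R : realType) (I K : countType) (T : {linear ell2 R I -> ell2 R K}).

(** The constant [q] is the square of the operator norm, so later estimates involve inner products
    only. *)
Lemma opnorm_lt1 : (opnorm T < 1)%E ->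
  exists q : R, [/\ 0 <= q, q < 1 & forall u, dotl2 (T u) (T u) <= q * dotl2 u u].
Proof.
move=> T1.
have ub u : norml2 u <= 1 -> ((norml2 (T u))%:E <= opnorm T)%E.
  by move=> u1; apply: ereal_sup_ubound; exists u.
have n0 : norml2 (0 : ell2 R I) <= 1 by rewrite /norml2 dot0l sqrtr0.
have T0 : (0 <= opnorm T)%E.
  by apply: le_trans (ub _ n0); rewrite lee_fin sqrtr_ge0.
have fT : opnorm T \is a fin_num by rewrite ge0_fin_numE// (lt_trans T1)// ltry.
set s := fine (opnorm T); have sE : opnorm T = s%:E by rewrite fineK.
have s0 : 0 <= s by rewrite -lee_fin -sE.
have s1 : s < 1 by rewrite -lte_fin -sE.
exists (s ^+ 2); split; [exact: sqr_ge0 | by rewrite expr_lt1 | move=> u].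
have [u0|u0] := leP (dotl2 u u) 0.
  by rewrite (dotuu_eq0 u0) linear0 !dot0l mulr0.
set n := norml2 u; have n_gt0 : 0 < n by rewrite sqrtr_gt0.
have un : dotl2 u u = n ^+ 2 by rewrite norml2_sq.
pose v := n^-1 *: u.
have vv : dotl2 v v = 1.
  by rewrite /v dotZl dotZr un; field; rewrite gt_eqF.
have uv : u = n *: v by rewrite /v scalerA mulfV ?scale1r// gt_eqF.
have : norml2 (T v) <= s.
  by rewrite -lee_fin -sE; apply: ub; rewrite /norml2 vv sqrtr1.
rewrite -(@ler_pXn2r _ 2)// ?nnegrE ?sqrtr_ge0// norml2_sq => h.
rewrite {1 2}uv linearZ dotZl dotZr un mulrA -expr2 mulrC.
by rewrite ler_wpM2r// sqr_ge0.
Qed.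

Variable q : R.
Hypothesis q0 : 0 <= q.
Hypothesis Tq : forall u, dotl2 (T u) (T u) <= q * dotl2 u u.

(** As [adjoint] is selected by [xget], existence has to be shown: [riesz] is applied to the form
    sending [u] to [dotl2 (T u) v]. *)
Lemma adjointP u v : dotl2 (T u) v = dotl2 u (adjoint T v).
Proof.
suff h : exists w, forall u, dotl2 (T u) v = dotl2 u w by exact: (xgetPex 0 h).
have [||||w wP] := @riesz R I (fun u => dotl2 (T u) v) (q * dotl2 v v).
- by rewrite mulr_ge0// dotuu_ge0.
- by move=> x y; rewrite linearD dotDl.
- by move=> c x; rewrite linearZ dotZl.
- move=> x; apply: le_trans (dot_CS _ _) _; rewrite mulrAC.
  by rewrite ler_wpM2r// dotuu_ge0.
by exists w => x; rewrite wP dotC.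
Qed.

Lemma adjoint_coord v i : adjoint T v i = dotl2 (T (basis R i)) v.
Proof. by rewrite adjointP dotC dot_basis. Qed.

End bounded_operators.

(** * The thresholding function *)

Section thresholding_theory.
Variables (R : realType) (p : R).
Implicit Types x y z t l r : R.

(* [y] is half a subgradient of [|.|^p] at [x]; for [p > 1] this says
   [Fp p x = x + y], and for [p = 1] it is soft thresholding. *)
Definition half_subgrad x y : Prop :=
  forall z, `|x| `^ p + 2 * y * (z - x) <= `|z| `^ p.

Lemma half_subgrad_mono x y x' y' : half_subgrad x y -> half_subgrad x' y' ->
  0 <= (x - x') * (y - y').
Proof. by move=> /(_ x') h /(_ x) h'; nra. Qed.

(** The subgradient condition makes [x] the proximal point of [l]: expanding the squares leaves the
    surplus [(z - x) ^+ 2]. *)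
Lemma half_subgrad_min x l : half_subgrad x (l - x) ->
  forall z, (x - l) ^+ 2 + `|x| `^ p <= (z - l) ^+ 2 + `|z| `^ p.
Proof. by move=> h z; have := h z; have := sqr_ge0 (z - x); nra. Qed.

Lemma half_subgrad_eq x x' l :
  half_subgrad x (l - x) -> half_subgrad x' (l - x') -> x = x'.
Proof.
move=> h h'; have := half_subgrad_mono h h'; have := sqr_ge0 (x - x') => h1 h2.
by apply/eqP; rewrite -subr_eq0 -sqrf_eq0 eq_le h1 andbT; nra.
Qed.

(** The subgradient [c] at the limit stands in for continuity of the power: it bounds the power of
    [a n] from below by an affine expression whose limit is the power of [x]. *)
Lemma half_subgrad_closed (T : Type) (F : set_system T) (a b : T -> R) x y c :
  ProperFilter F -> half_subgrad x c ->
  a n @[n --> F] --> x -> b n @[n --> F] --> y ->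
  (forall n, half_subgrad (a n) (b n)) -> half_subgrad x y.
Proof.
move=> PF hc ax bY hab z.
apply: (@cvgr_to_le _ F _ _
  (fun n => `|x| `^ p + 2 * c * (a n - x) + 2 * (b n * (z - a n)))); last first.
  apply: filterS filterT => n _; have := hab n z; have := hc (a n); lra.
rewrite (_ : _ + _ = `|x| `^ p + 2 * c * (x - x) + 2 * (y * (z - x))); last by ring.
apply: cvgD; last by apply: cvgMr; apply: cvgM => //; apply: cvgB => //; exact: cvg_cst.
apply: cvgD; first exact: cvg_cst.
by apply: cvgMr; apply: cvgB => //; exact: cvg_cst.
Qed.

Hypothesis p1 : 1 < p.

(* Young's inequality applied to [x] and [t^(p-1)]. *)
Lemma powR_tangent x t : 0 <= x -> 0 <= t ->
  t `^ p + p * t `^ (p - 1) * (x - t) <= x `^ p.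
Proof.
move=> x0 t0; have p0 : 0 < p by move: p1; lra.
have p10 : 0 < p - 1 by move: p1; lra.
have pN0 : p != 0 by rewrite gt_eqF.
have p1N0 : p - 1 != 0 by rewrite gt_eqF.
have := @conjugate_powR R x (t `^ (p - 1)) p (p / (p - 1)) x0 (powR_ge0 _ _) p0 (divr_gt0 p0 p10).
rewrite -powRrM (_ : (p - 1) * (p / (p - 1)) = p); last by field.
have -> : p^-1 + (p / (p - 1))^-1 = 1 by field; rewrite ?pN0 ?p1N0.
move=> /(_ erefl); rewrite -(mulr_powRB1 t0 p0).
rewrite -(ler_pM2l p0).
rewrite (_ : p * (x `^ p / p + t * t `^ (p - 1) / (p / (p - 1)))
  = x `^ p + (p - 1) * (t * t `^ (p - 1))); last by field; rewrite ?pN0 ?p1N0.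
nra.
Qed.

Lemma half_subgrad_Fp t : half_subgrad t (Fp p t - t).
Proof.
move=> z; have := powR_tangent (normr_ge0 z) (normr_ge0 t).
apply: le_trans; rewrite lerD2l /Fp.
have -> : 2 * (t + p / 2 * Num.sg t * `|t| `^ (p - 1) - t) * (z - t)
  = p * `|t| `^ (p - 1) * (Num.sg t * z - Num.sg t * t) by field.
apply: ler_wpM2l; first by rewrite mulr_ge0 ?powR_ge0//; move: p1; lra.
rewrite -normrEsg lerD2r; apply: le_trans (ler_norm _) _.
by rewrite normrM normr_sg ler_piMl//; case: (t != 0).
Qed.

Lemma norm_FpB t : `|Fp p t - t| = p / 2 * `|t| `^ (p - 1).
Proof.
have p10 : p - 1 != 0 by rewrite gt_eqF//; move: p1; lra.
rewrite /Fp addrAC subrr add0r !normrM normr_sg.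
rewrite -normrM (ger0_norm (powR_ge0 _ _)) ger0_norm; last by move: p1; lra.
by have [->|_] := eqVneq t 0; rewrite ?mulr1// normr0 powR0// !mulr0.
Qed.

Lemma norm_Fp t : `|Fp p t| = `|t| + p / 2 * `|t| `^ (p - 1).
Proof.
have p10 : p - 1 != 0 by rewrite gt_eqF//; move: p1; lra.
have [->|t0] := eqVneq t 0; first by rewrite /Fp sgr0 !normr0 powR0// !mulr0 addr0 normr0.
have -> : Fp p t = Num.sg t * (`|t| + p / 2 * `|t| `^ (p - 1)).
  by rewrite mulrDr -numEsg /Fp; ring.
rewrite normrM normr_sg t0 mul1r.
by rewrite ger0_norm// addr_ge0// mulr_ge0 ?powR_ge0//; move: p1; lra.
Qed.

Lemma powR_continuous_itv (a b : R) : 0 < a -> 0 < b ->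
  {within `[0, b], continuous (fun t => t `^ a)}.
Proof.
move=> a0 b0.
have pos x : 0 < x -> {for x, continuous (fun t => t `^ a)}.
  move=> x0; apply/differentiable_continuous/derivable1_diffP.
  by have [] := is_derive1_powR a x0.
apply/(continuous_within_itvP _ b0); split.
- by move=> x; rewrite in_itv /= => /andP[x0 _]; exact: pos.
- by rewrite powR0 ?gt_eqF//; exact: powR_cvg0.
- exact/cvg_at_left_filter/pos.
Qed.

(** Oddness reduces to [l > 0], where the intermediate value theorem applies on [[0, l]] since the
    value at [l] is at least [l]. *)
Lemma Fp_surj l : exists t, Fp p t = l.
Proof.
have p10 : 0 < p - 1 by move: p1; lra.
wlog l0 : l / 0 < l.
  move=> H; have [l0|l0|<-] := ltgtP 0 l; first exact: H.
    have [t tl] : exists t, Fp p t = - l by apply: H; move: p1; lra.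
    exists (- t); rewrite /Fp sgrN normrN; move: tl; rewrite /Fp; move: p1; lra.
  by exists 0; rewrite /Fp sgr0 mulr0 mul0r addr0.
have c : {within `[0, l], continuous (fun t => t + p / 2 * t `^ (p - 1))}.
  have cid : {within `[0, l], continuous (fun t : R => t)}.
    by apply: continuous_subspaceT => x; exact: cvg_id.
  move=> x; apply: cvgD; first exact: cid.
  by apply: cvgMr; exact: powR_continuous_itv.
have [|t] := @IVT R (fun t => t + p / 2 * t `^ (p - 1)) 0 l l (ltW l0) c.
  rewrite powR0 ?gt_eqF// mulr0 addr0 ge_min (ltW l0)/= le_max lerDl.
  by rewrite mulr_ge0 ?powR_ge0 ?orbT//; move: p1; lra.
rewrite in_itv /= => /andP[t0 _] tl; exists t; rewrite -tl /Fp ger0_norm//.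
move: t0; rewrite le_eqVlt => /orP[/eqP <-|t0].
  by rewrite sgr0 powR0 ?gt_eqF// !mulr0.
by rewrite gtr0_sg// mulr1.
Qed.

Lemma Fpinv_spec l : Fp p (Fpinv p l) = l.
Proof. exact: (xgetPex 0 (Fp_surj l)). Qed.

Lemma half_subgrad_Fpinv l : half_subgrad (Fpinv p l) (l - Fpinv p l).
Proof. by have := half_subgrad_Fp (Fpinv p l); rewrite Fpinv_spec. Qed.

(* Minty's argument: [Fp p] being onto, its subgradient graph is maximal monotone. *)
Lemma half_subgradE x y : half_subgrad x y -> y = Fp p x - x.
Proof.
move=> h; have hx : half_subgrad x ((x + y) - x) by rewrite addrC addKr.
have xE := half_subgrad_eq hx (half_subgrad_Fpinv _).
by rewrite xE Fpinv_spec -xE; ring.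
Qed.

Lemma powRB1_le x y : 0 <= x -> x <= y -> x `^ (p - 1) <= y `^ (p - 1).
Proof.
move=> x0 xy; have y0 := le_trans x0 xy.
by apply: ge0_ler_powR; rewrite ?nnegrE//; move: p1; lra.
Qed.

Lemma powR_le x y : 0 <= x -> x <= y -> x `^ p <= y `^ p.
Proof.
move=> x0 xy; have y0 := le_trans x0 xy.
by apply: ge0_ler_powR; rewrite ?nnegrE//; move: p1; lra.
Qed.

(** For [p > 1], the minimum over [x] of [(x - l) ^+ 2 + |x| ^ p], written in terms of [t], the
    modulus of the minimiser [Fpinv p l]. The equation defining [lambda'] says that this minimum
    equals the cap [r ^ p]. *)
Definition surrogate_min t : R := (p / 2 * t `^ (p - 1)) ^+ 2 + t `^ p.

Lemma surrogate_min_le x y : 0 <= x -> x <= y -> surrogate_min x <= surrogate_min y.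
Proof.
move=> x0 xy; apply: lerD; last exact: powR_le.
have p20 : 0 <= p / 2 by move: p1; lra.
apply: lerXn2r; rewrite ?nnegrE ?(mulr_ge0 p20 (powR_ge0 _ _))//.
by rewrite ler_wpM2l// powRB1_le.
Qed.

Lemma surrogate_minE l :
  (Fpinv p l - l) ^+ 2 + `|Fpinv p l| `^ p = surrogate_min `|Fpinv p l|.
Proof.
by rewrite /surrogate_min -norm_FpB Fpinv_spec real_normK ?num_real// -sqrrN opprB.
Qed.

Lemma norm_Fpinv_mono l l' : `|Fpinv p l| < `|Fpinv p l'| -> `|l| < `|l'|.
Proof.
move=> h; rewrite -(Fpinv_spec l) -(Fpinv_spec l') !norm_Fp.
apply: ltr_leD => //; apply: ler_wpM2l; first by move: p1; lra.
by apply: powRB1_le => //; exact: ltW.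
Qed.

Lemma lambda'_exists r : 0 < r ->
  exists l, r < l < r + p / 2 * r `^ (p - 1) /\
            (Fpinv p l - l) ^+ 2 + `|Fpinv p l| `^ p = r `^ p.
Proof.
move=> r0; have p10 : 0 < p - 1 by move: p1; lra.
have c : {within `[0, r], continuous surrogate_min}.
  move=> x; rewrite /surrogate_min; apply: cvgD; last first.
    by apply: powR_continuous_itv => //; move: p1; lra.
  have c1 : {within `[0, r], continuous (fun t => p / 2 * t `^ (p - 1))}.
    by move=> z; apply: cvgMr; exact: powR_continuous_itv.
  exact: (cvgM (c1 x) (c1 x)).
have rr : r `^ p < surrogate_min r.
  by rewrite ltrDr exprn_gt0// mulr_gt0 ?powR_gt0//; move: p1; lra.
(* The equation is solved for the modulus [t] of the minimiser rather than for [l]; the witness is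
   then [Fp p t]. *)
have [|t] := @IVT R surrogate_min 0 r (r `^ p) (ltW r0) c.
  rewrite {1 3}/surrogate_min !powR0 ?gt_eqF//; last by move: p1; lra.
  by rewrite mulr0 expr0n addr0 ge_min powR_ge0/= le_max (ltW rr) orbT.
rewrite in_itv /= => /andP[t0 tr] tE.
have {}tr : t < r.
  by rewrite lt_neqAle tr andbT; apply/eqP => trE; move: rr; rewrite -tE trE ltxx.
have {}t0 : 0 < t.
  rewrite lt_neqAle t0 andbT; apply/eqP => t0'; move: tE.
  rewrite -t0' /surrogate_min !powR0 ?gt_eqF//; last by move: p1; lra.
  rewrite mulr0 expr0n addr0 => /esym/powR_eq0_eq0 /eqP; move: p1; lra.
have FtE : Fp p t = t + p / 2 * t `^ (p - 1).
  by rewrite /Fp gtr0_sg// mulr1 gtr0_norm.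
have it : Fpinv p (Fp p t) = t.
  apply: (half_subgrad_eq (half_subgrad_Fpinv _)).
  exact: half_subgrad_Fp.
exists (Fp p t); split; last by rewrite surrogate_minE it gtr0_norm.
have tp := powR_gt0 (p - 1) t0.
have pp : 0 < p / 2 by move: p1; lra.
have at0 := mulr_gt0 pp tp.
apply/andP; split.
  (* With [a = p / 2 * t ^ (p - 1)], the tangent at [t] evaluated at [r] gives
     [2 * a * (r - t) <= a ^ 2]. Hence [a >= 2 * (r - t)], and [t + a >= 2 * r - t > r]. *)
  have := powR_tangent (ltW r0) (ltW t0); rewrite -tE /surrogate_min FtE.
  move=> h; have {h} : 0 <= (p / 2 * t `^ (p - 1)) * (p / 2 * t `^ (p - 1) - 2 * (r - t)).
    by move: h; nra.
  rewrite pmulr_rge0//; move: p1; lra.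
rewrite FtE ltr_leD//; apply: ler_wpM2l; first exact: ltW.
by apply: powRB1_le; exact: ltW.
Qed.

Lemma lambda'_gt1E r : 0 < r ->
  [/\ r < lambda' r p, 0 < Fpinv p (lambda' r p), Fpinv p (lambda' r p) < r &
      surrogate_min (Fpinv p (lambda' r p)) = r `^ p].
Proof.
move=> r0; have := xgetPex 0 (lambda'_exists r0).
have -> : xget 0 [set l | r < l < r + p / 2 * r `^ (p - 1) /\
    (Fpinv p l - l) ^+ 2 + `|Fpinv p l| `^ p = r `^ p] = lambda' r p.
  by rewrite /lambda' gt_eqF.
set l := lambda' r p; set t := Fpinv p l => -[/andP[rl lr]].
rewrite surrogate_minE => tE.
have tp : 0 < t.
  rewrite ltNge; apply/negP => t0; have : l <= 0; last by move: r0 rl; lra.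
  have h : Fp p t = l := Fpinv_spec l.
  have pos : 0 <= p / 2 * `|t| `^ (p - 1) by rewrite mulr_ge0 ?powR_ge0//; move: p1; lra.
  rewrite -h /Fp; move: t0; rewrite le_eqVlt => /orP[/eqP ->|t0].
    by rewrite sgr0 mulr0 mul0r addr0.
  by rewrite ltr0_sg//; move: t0 pos; lra.
rewrite -/t gtr0_norm// in tE.
split => //; rewrite ltNge; apply/negP => rt.
have := surrogate_min_le (ltW r0) rt; rewrite tE /surrogate_min leNgt ltrDr.
rewrite exprn_gt0// mulr_gt0 ?powR_gt0//; move: p1; lra.
Qed.

End thresholding_theory.

(** * The thresholding function as a minimiser of the truncated problem *)

Section threshold_map.
Variables (R : realType) (p r : R).
Hypotheses (p1 : 1 <= p) (r0 : 0 < r) (pr : p = 1 -> 1 / 4 <= r).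
Implicit Types x l : R.

(** The lower end of the jump of [Hthr] at [lambda'], given uniformly in [p]. *)
Definition lower_level : R := if p == 1 then r - 1 / 4 else Fpinv p (lambda' r p).

Lemma lower_level_bounds :
  [/\ 0 <= lower_level, lower_level <= r & r < lambda' r p].
Proof.
rewrite /lower_level; have [pe|pn] := eqVneq p 1.
  by have := pr pe; rewrite /lambda' pe eqxx => h; split; lra.
have p1' : 1 < p by rewrite lt_neqAle eq_sym pn.
by have [h1 h2 h3 _] := lambda'_gt1E p1' r0; split => //; exact: ltW.
Qed.

Definition soft l : R := if `|l| <= 1 / 2 then 0 else (`|l| - 1 / 2) * Num.sg l.

Lemma soft_value l : (`|l| <= 1 / 2 /\ soft l = 0) \/
  [/\ 1 / 2 < `|l|, `|soft l| = `|l| - 1 / 2 & (soft l - l) ^+ 2 = 1 / 4].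
Proof.
rewrite /soft; case: ifPn => [|]; [by left | rewrite -ltNge => l2; right].
have [l0|l0|l0] := ltgtP l 0; last by move: l2; rewrite l0 normr0; lra.
  move: l2; rewrite ltr0_sg// ltr0_norm// => l2.
  by rewrite ler0_norm; [split => //; [lra | field] | lra].
move: l2; rewrite gtr0_sg// gtr0_norm// => l2.
by rewrite ger0_norm; [split => //; [lra | field] | lra].
Qed.

Lemma half_subgrad_soft l : half_subgrad 1 (soft l) (l - soft l).
Proof.
move=> z; rewrite /soft !powRr1//; case: ifPn => [|]; last rewrite -ltNge => l2.
  rewrite normr0 !subr0 add0r ler_norml => /andP[l1 l2].
  by case: (ger0P z) => z0; nra.
have [l0|l0|l0] := ltgtP l 0; last by move: l2; rewrite l0 normr0; lra.
  move: l2; rewrite ltr0_sg// ltr0_norm// => l2; rewrite ler0_norm; last by lra.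
  by case: (ger0P z) => z0; nra.
move: l2; rewrite gtr0_sg// gtr0_norm// => l2; rewrite ger0_norm; last by lra.
by case: (ger0P z) => z0; nra.
Qed.

Lemma half_subgrad1P x y : half_subgrad 1 x y ->
  [/\ - (1 / 2) <= y, y <= 1 / 2 & x != 0 -> y = 1 / 2 * Num.sg x].
Proof.
(* The points [x + 1] and [x - 1] bound [y]; the points [0] and [2 * x] together force
   [2 * y * x = |x|]. *)
move=> h; have h1 := h (x + 1); have h2 := h (x - 1); have h3 := h 0; have h4 := h (2 * x).
move: h1 h2 h3 h4; rewrite !powRr1// => h1 h2 h3 h4.
have := ler_normD x 1; have := ler_normB x 1; rewrite normr1 => h5 h6.
split; [by lra | by lra | move=> xn0].
move: h3 h4; rewrite normr0 normrM (@ger0_norm _ 2)//.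
have [xl|xl|xe] := ltgtP x 0; last by rewrite xe eqxx in xn0.
  rewrite ltr0_norm// ltr0_sg// => h3 h4.
  have /eqP : x * (y + 1 / 2) = 0 by lra.
  by rewrite mulf_eq0 (negbTE xn0) /= => /eqP; lra.
rewrite gtr0_norm// gtr0_sg// => h3 h4.
have /eqP : x * (y - 1 / 2) = 0 by lra.
  by rewrite mulf_eq0 (negbTE xn0) /= => /eqP; lra.
Qed.

(** Supplies the auxiliary subgradient that [half_subgrad_closed] asks for. *)
Lemma half_subgrad_ex x : exists c, half_subgrad p x c.
Proof.
have [->|pn] := eqVneq p 1; last first.
  by exists (Fp p x - x); apply: half_subgrad_Fp; rewrite lt_neqAle eq_sym pn.
exists (1 / 2 * Num.sg x) => z; rewrite !powRr1//.
have -> : 2 * (1 / 2 * Num.sg x) * (z - x) = Num.sg x * z - `|x|.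
  by rewrite normrEsg; field.
rewrite addrC subrK; apply: le_trans (ler_norm _) _.
by rewrite normrM normr_sg ler_piMl//; case: (x != 0).
Qed.

(** The level [lambda'] is the break-even point: up to it the proximal value costs at most the cap
    [r ^ p], beyond it even the proximal minimum costs at least the cap, so leaving [l] unchanged is
    optimal. *)
Lemma Hthr_cases l :
  (`|l| <= lambda' r p /\
   [/\ `|Hthr p r l| <= lower_level, half_subgrad p (Hthr p r l) (l - Hthr p r l) &
       (Hthr p r l - l) ^+ 2 + `|Hthr p r l| `^ p <= r `^ p]) \/
  (lambda' r p < `|l| /\ Hthr p r l = l /\
   forall x, r `^ p <= (x - l) ^+ 2 + `|x| `^ p).
Proof.
have [pe|pn] := eqVneq p 1.
  have r4 := pr pe; have hs := half_subgrad_soft l.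
  have hm := half_subgrad_min hs.
  rewrite /lower_level /lambda' pe eqxx.
  have [lr|lr] := leP `|l| (r + 1 / 4).
    have -> : Hthr 1 r l = soft l by rewrite /Hthr eqxx lr /soft.
    left; split => //; rewrite !powRr1 ?(ltW r0)//.
    have [[l2 s0]|[l2 sn sq]] := soft_value l; last by rewrite sn sq; split => //; lra.
    rewrite s0 in hs *; rewrite normr0 addr0 sub0r sqrrN; split => //; first by lra.
    by move: l2; rewrite ler_norml => /andP[]; nra.
  have l2 : 1 / 2 < `|l| by lra.
  right; split => //; split => [|x].
    by rewrite /Hthr eqxx !leNgt l2 lr.
  apply: le_trans (hm x); rewrite !powRr1 ?(ltW r0)//.
  by have [[]|[_ sn sq]] := soft_value l; [lra | rewrite sn sq; lra].
have p1' : 1 < p by rewrite lt_neqAle eq_sym pn.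
have [_ t0 tr tE] := lambda'_gt1E p1' r0.
have la0 : 0 < lambda' r p by have [_ _] := lower_level_bounds; move: r0; lra.
rewrite /lower_level /Hthr (negbTE pn).
have lt0 : `|Fpinv p (lambda' r p)| = Fpinv p (lambda' r p) by rewrite gtr0_norm.
have [lr|lr] := leP `|l| (lambda' r p).
  have ht : `|Fpinv p l| <= Fpinv p (lambda' r p).
    rewrite leNgt; apply/negP; rewrite -lt0 => /(norm_Fpinv_mono p1').
    by rewrite (gtr0_norm la0) ltNge lr.
  left; split => //; split => //; first exact: half_subgrad_Fpinv.
  by rewrite surrogate_minE// -tE; apply: surrogate_min_le.
right; split => //; split => // x.
apply: le_trans (half_subgrad_min (half_subgrad_Fpinv p1' l) x).
rewrite surrogate_minE// -tE; apply: surrogate_min_le; [by []|exact: ltW|].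
rewrite leNgt; apply/negP => h; move: lr; rewrite ltNge => /negP; apply.
apply: ltW; rewrite -(gtr0_norm la0); apply: (norm_Fpinv_mono p1').
by rewrite lt0.
Qed.

Definition trunc_pow x : R := Num.min (`|x| `^ p) (r `^ p).

Lemma trunc_pow_ge0 x : 0 <= trunc_pow x.
Proof. by rewrite /trunc_pow le_min !powR_ge0. Qed.

Lemma Hthr_min l x :
  (Hthr p r l - l) ^+ 2 + trunc_pow (Hthr p r l) <= (x - l) ^+ 2 + trunc_pow x.
Proof.
have sq := sqr_ge0 (x - l).
have [[_ [_ hs hr]]|[_ [hl hx]]] := Hthr_cases l.
  apply: (@le_trans _ _ ((Hthr p r l - l) ^+ 2 + `|Hthr p r l| `^ p)).
    by rewrite lerD2l /trunc_pow ge_min lexx.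
  rewrite /trunc_pow; case: (leP (`|x| `^ p) (r `^ p)) => _; first exact: (half_subgrad_min hs x).
  by apply: le_trans hr _; rewrite lerDr.
rewrite hl subrr expr0n add0r.
apply: (@le_trans _ _ (r `^ p)); first by rewrite /trunc_pow ge_min lexx orbT.
by rewrite /trunc_pow; case: (leP (`|x| `^ p) (r `^ p)) => _ //; rewrite lerDr.
Qed.

Lemma lambda'_subr_jump : p != 1 -> lambda' r p - jump r p = lower_level.
Proof.
move=> pn; have p1' : 1 < p by rewrite lt_neqAle eq_sym pn.
have [rl t0 tr _] := lambda'_gt1E p1' r0.
rewrite /jump /Hthr /lower_level (negbTE pn) (gtr0_norm (lt_trans r0 rl)).
rewrite lexx ger0_norm; [ring | rewrite subr_ge0; exact/ltW/(lt_trans tr)].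
Qed.

End threshold_map.

(** * Weak convergence of proximal iterations *)

Section finite_support.
Variables (R : realType) (I : countType).
Implicit Types (u v : ell2 R I) (s : seq I).

Lemma fproj_out s (f : I -> R) i : i \notin s -> fproj s f i = 0.
Proof.
move=> si; rewrite /fproj ell2_sum big1_seq// => j /andP[_ js].
rewrite ell2Z /= (_ : i == j = false) ?mulr0//.
by apply: contraNF si => /eqP ->.
Qed.

Lemma fproj_id s u : uniq s -> (forall i, i \notin s -> u i = 0) -> fproj s u = u.
Proof.
move=> us u0; apply: ell2P => i; have [si|si] := boolP (i \in s).
  exact: fprojE.
by rewrite fproj_out// u0.
Qed.

Lemma dot_supp s u v : uniq s -> (forall i, i \notin s -> v i = 0) ->
  dotl2 u v = \sum_(i <- s) u i * v i.
Proof. by move=> us v0; rewrite -{1}(fproj_id us v0) dot_fproj. Qed.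

Lemma ell2_large_finite u (c : R) : 0 < c ->
  exists2 s, uniq s & forall i, i \notin s -> u i ^+ 2 < c.
Proof.
move=> c0; have [s us hs] := fproj_approx u c0.
exists s => // i si; apply: le_lt_trans hs.
by have := sq_le_dot (u - fproj s u) i; rewrite ell2B fproj_out// subr0.
Qed.

End finite_support.

(** * Coercivity on finite supports, the metric of the iteration and the residual *)

Section operator_estimates.
Variables (R : realType) (I K : countType) (T : {linear ell2 R I -> ell2 R K}).
Variable q : R.
Hypothesis q0 : 0 <= q.
Hypothesis Tq : forall u, dotl2 (T u) (T u) <= q * dotl2 u u.

(* A normalised minimising sequence would have a weak limit in the kernel of [T],
   orthogonal to itself; finite support makes the convergence strong. *)
Lemma finite_support_coercive (s : seq I) : uniq s ->
  exists2 C : R, 0 <= C &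
  forall d : ell2 R I, (forall i, i \notin s -> d i = 0) ->
    (forall k : ell2 R I, (forall i, i \notin s -> k i = 0) -> T k = 0 -> dotl2 d k = 0) ->
    dotl2 d d <= C * dotl2 (T d) (T d).
Proof.
move=> us; apply: contrapT => H.
(* Normalised counterexamples to the constant [n.+1]. *)
pose P (n : nat) (d : ell2 R I) := [/\ forall i, i \notin s -> d i = 0,
    forall k : ell2 R I, (forall i, i \notin s -> k i = 0) -> T k = 0 -> dotl2 d k = 0,
    dotl2 d d = 1 & n.+1%:R * dotl2 (T d) (T d) <= 1].
have /choice[e eP] : forall n, exists d, P n d.
  move=> n; apply: contrapT => nP; apply: H; exists n.+1%:R => // d ds dk.
  rewrite leNgt; apply/negP => hd; apply: nP.
  have d0 : 0 < dotl2 d d.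
    by apply: le_lt_trans hd; rewrite mulr_ge0// dotuu_ge0.
  pose c := Num.sqrt (dotl2 d d); have c0 : 0 < c by rewrite sqrtr_gt0.
  have c2 : c ^+ 2 = dotl2 d d by rewrite sqr_sqrtr ?ltW.
  exists (c^-1 *: d); split.
  - by move=> i si; rewrite ell2Z ds// mulr0.
  - by move=> k ks Tk; rewrite dotZl dk// mulr0.
  - by rewrite dotZl dotZr -c2; field; rewrite gt_eqF.
  - rewrite linearZ dotZl dotZr (_ : _ * _ = n.+1%:R * dotl2 (T d) (T d) / c ^+ 2).
      by rewrite ler_pdivrMr ?exprn_gt0// mul1r c2 ltW.
    by field; rewrite gt_eqF.
have [W [UW ooW]] := @ultraFilterLemma nat \oo _.
have e_le1 n : dotl2 (e n) (e n) <= 1 by have [_ _ -> _] := eP n.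
have [w wP] := weak_ultra_lim UW e_le1.
have ws i : i \notin s -> w i = 0.
  move=> si; rewrite -dot_basis; apply: (cvgR_unique (wP _)).
  under eq_fun => n do [rewrite dot_basis; have [es _ _ _] := eP n; rewrite es//].
  exact: cvg_cst.
have Tw : T w = 0.
  apply: dotuu_eq0; set v := T w.
  (* The inner product equals [dotl2 (T (e n)) v], whose square is at most [dotl2 v v / n.+1] by
     Cauchy-Schwarz; its weak limit is [dotl2 v v]. *)
  have h : dotl2 (e n) (adjoint T v) ^+ 2 @[n --> W] --> (0 : R).
    apply: (@squeeze_cvgr _ W _ _ (fun=> 0) (fun n => dotl2 v v * n.+1%:R^-1)).
    - apply: filterS filterT => n _; rewrite sqr_ge0 /= -(adjointP q0 Tq).
      apply: le_trans (dot_CS _ _) _; rewrite mulrC ler_wpM2l ?dotuu_ge0//.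
      have [_ _ _] := eP n; rewrite -ler_pdivlMl// mulr1//.
    - exact: cvg_cst.
    - rewrite -[X in _ --> X](mulr0 (dotl2 v v)); apply: cvgMr.
      by apply: cvg_trans (@cvg_harmonic R); apply: cvg_app.
  have h' : dotl2 (e n) (adjoint T v) ^+ 2 @[n --> W] --> dotl2 v v ^+ 2.
    by rewrite {2}/v (adjointP q0 Tq); exact: (cvgM (wP _) (wP _)).
  have h2 : dotl2 v v ^+ 2 = 0 := cvgR_unique (PF := @ultra_proper _ _ UW) h' h.
  by move/eqP: h2; rewrite sqrf_eq0 => /eqP ->.
have w0 : w = 0.
  apply: dotuu_eq0; rewrite le_eqVlt; apply/orP; left; apply/eqP.
  apply: (cvgR_unique (wP w)).
  under eq_fun => n do [have [_ ek _ _] := eP n; rewrite ek//].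
  exact: cvg_cst.
have h0 : \sum_(i <- s) e n i * e n i @[n --> W] --> \sum_(i <- s) (0 : R).
  have hi i : e n i * e n i @[n --> W] --> (0 : R).
    rewrite -[X in _ --> X](mulr0 0).
    have {}hi : e n i @[n --> W] --> (0 : R).
      have := wP (basis R i); rewrite w0 dot0l.
      by under eq_fun do rewrite dot_basis.
    exact: cvgM.
  elim: (s) => [|i a ih]; rewrite ?big_nil ?big_cons.
    by under eq_fun do rewrite big_nil; exact: cvg_cst.
  by under eq_fun do rewrite big_cons; exact: cvgD.
have h1 : \sum_(i <- s) e n i * e n i @[n --> W] --> (1 : R).
  under eq_fun => n do [have [es _ e1 _] := eP n; rewrite -(dot_supp _ us es) e1].
  exact: cvg_cst.
have h2 : 1 = \sum_(i <- s) (0 : R) := cvgR_unique (PF := @ultra_proper _ _ UW) h1 h0.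
by move/eqP: h2; rewrite big1// oner_eq0.
Qed.

Hypothesis q1 : q < 1.

Implicit Types u v z : ell2 R I.

(** The inner product induced by the identity minus [adjoint T] after [T]; since [q < 1] it is
    positive definite. *)
Definition defect_form (u v : ell2 R I) : R := dotl2 u v - dotl2 (T u) (T v).

Lemma defect_form_ge u : (1 - q) * dotl2 u u <= defect_form u u.
Proof. by rewrite /defect_form; have := Tq u; lra. Qed.

Lemma defect_form_ge0 u : 0 <= defect_form u u.
Proof.
apply: le_trans (defect_form_ge u); rewrite mulr_ge0 ?dotuu_ge0//.
by move: q1; lra.
Qed.

Lemma defect_form_adjoint u v :
  defect_form u v = dotl2 u (v - adjoint T (T v)).
Proof. by rewrite /defect_form dotBr (adjointP q0 Tq). Qed.

Lemma defect_formB u z : defect_form (u - z) (u - z)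
  = defect_form u u - 2 * defect_form u z + defect_form z z.
Proof.
rewrite /defect_form (linearB T) !(dotBl, dotBr) (dotC z u) (dotC (T z) (T u)); ring.
Qed.

Lemma defect_formBr u z z' : defect_form u (z - z') = defect_form u z - defect_form u z'.
Proof. by rewrite /defect_form (linearB T) !dotBr; ring. Qed.

Lemma defect_formBl u z z' : defect_form (z - z') u = defect_form z u - defect_form z' u.
Proof. by rewrite /defect_form (linearB T) !dotBl; ring. Qed.

Variable g : ell2 R K.

Definition residual (u : ell2 R I) : ell2 R I := adjoint T (g - T u).

Lemma dot_residual u v : dotl2 v (residual u) = dotl2 (T v) (g - T u).
Proof. by rewrite /residual (adjointP q0 Tq). Qed.

(** Each coordinate of the residual is an affine function of one inner product with [u], hence
    passes to weak limits. *)
Lemma residual_coord u i :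
  residual u i = dotl2 (T (basis R i)) g - dotl2 u (adjoint T (T (basis R i))).
Proof.
rewrite -(dot_basis (residual u)) dotC dot_residual dotBr.
by rewrite (dotC _ (T u)) (adjointP q0 Tq u).
Qed.

Lemma landweberE u i : landweber T g u i = u i + residual u i.
Proof.
rewrite /landweber residual_coord ell2D ell2B !(adjoint_coord q0 Tq).
by rewrite (dotC _ (T u)) (adjointP q0 Tq u); ring.
Qed.

End operator_estimates.

Section opial.
Variables (R : realType) (I K : countType) (T : {linear ell2 R I -> ell2 R K}).
Variables (q : R) (g : ell2 R K).
Hypotheses (q0 : 0 <= q) (q1 : q < 1).
Hypothesis Tq : forall u, dotl2 (T u) (T u) <= q * dotl2 u u.
(** One monotone relation with closed graph per coordinate. It will be [half_subgrad] on small
    coordinates and the zero operator on large ones. *)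
Variable G : I -> R -> R -> Prop.
Hypothesis Gmono : forall i x y x' y', G i x y -> G i x' y' -> 0 <= (x - x') * (y - y').
Hypothesis Gclosed : forall i (W : set_system nat) (a b : nat -> R) (x y : R),
  ProperFilter W -> a n @[n --> W] --> x -> b n @[n --> W] --> y ->
  (forall n, G i (a n) (b n)) -> G i x y.
Variables (x : nat -> ell2 R I) (M : R).
Hypothesis xM : forall n, dotl2 (x n) (x n) <= M.
Hypothesis xreg : dotl2 (x n.+1 - x n) (x n.+1 - x n) @[n --> \oo] --> (0 : R).
Hypothesis xG : forall n i, G i (x n.+1 i) (x n i + residual T g (x n) i - x n.+1 i).

Let Q := defect_form T.

Implicit Types z : ell2 R I.

Definition stationary z := forall i, G i (z i) (residual T g z i).

(* The iteration is a proximal step in the metric of [defect_form T]. *)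
Lemma fejer z n : stationary z -> Q (x n.+1 - z) (x n.+1 - z) <= Q (x n - z) (x n - z).
Proof.
move=> zG; pose e := x n.+1 - z; pose f := x n - z.
have h : 0 <= dotl2 e (x n + residual T g (x n) - x n.+1 - residual T g z).
  by apply: dot_ge0 => i; rewrite !ell2B ell2D; exact: Gmono.
(* Monotonicity, summed over the coordinates, says exactly this. Then
   [2 * Q e e <= 2 * Q f e <= Q f f + Q e e], which is the claim. *)
have {}h : dotl2 e e <= defect_form T f e.
  rewrite -subr_ge0; apply: le_trans h _; rewrite le_eqVlt; apply/orP; left; apply/eqP.
  rewrite !(dotBr, dotDr) !(dot_residual q0 Tq) /defect_form (dotC f) (dotC (T f)).
  by rewrite /f /e !(linearB T) !(dotBl, dotBr); ring.
have h1 : defect_form T e e <= dotl2 e e by rewrite lerBlDr lerDl dotuu_ge0.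
have := defect_form_ge0 Tq q1 (f - e); rewrite defect_formB addrAC subr_ge0 => h2.
have h3 : 2 * defect_form T e e <= 2 * defect_form T f e.
  by rewrite ler_pM2l// (le_trans h1).
by have := le_trans h3 h2; rewrite mulr2n mulrDl !mul1r lerD2r.
Qed.

Lemma fejer_cvg z : stationary z ->
  exists l : R, Q (x n - z) (x n - z) @[n --> \oo] --> l.
Proof.
move=> zG; apply/cvg_ex; apply: nonincreasing_is_cvgn.
  by apply/nonincreasing_seqP => n; exact: fejer.
by exists 0 => _ [n _ <-]; exact: (defect_form_ge0 Tq q1).
Qed.

(** Coordinates and residuals converge by weak convergence, regularity gives [x n.+1] the same
    limits as [x n], and the graphs are closed. *)
Lemma ultra_stationary (W : set_system nat) z : UltraFilter W -> \oo `<=` W ->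
  (forall v, dotl2 (x n) v @[n --> W] --> dotl2 z v) -> stationary z.
Proof.
move=> UW ooW zP i.
have xi : x n i @[n --> W] --> z i.
  have := zP (basis R i); rewrite dot_basis.
  by under eq_fun do rewrite dot_basis.
have ri : residual T g (x n) i @[n --> W] --> residual T g z i.
  rewrite (residual_coord q0 Tq).
  under eq_fun do rewrite (residual_coord q0 Tq).
  by apply: cvgB; [exact: cvg_cst | exact: zP].
have di : x n.+1 i - x n i @[n --> W] --> (0 : R).
  apply/cvgrPdist_lt => e e0.
  have e2 : 0 < e ^+ 2 by exact: exprn_gt0.
  apply: ooW; have /cvgrPdist_lt /(_ _ e2) := xreg; apply: filterS => n.
  rewrite !sub0r !normrN ger0_norm ?dotuu_ge0// => h.
  rewrite -(@ltr_pXn2r _ 2)// ?nnegrE ?(ltW e0)// real_normK ?num_real//.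
  by apply: le_lt_trans h; have := sq_le_dot (x n.+1 - x n) i; rewrite ell2B.
have x1i : x n.+1 i @[n --> W] --> z i.
  have -> : (fun n => x n.+1 i) = (fun n => x n i + (x n.+1 i - x n i)).
    by apply/funext => n; rewrite addrC subrK.
  by rewrite -[X in _ --> X]addr0; exact: cvgD xi di.
apply: (@Gclosed _ W (fun n => x n.+1 i)
   (fun n => x n i + residual T g (x n) i - x n.+1 i)) => //.
rewrite (_ : residual T g z i = z i + residual T g z i - z i); last by rewrite addrAC subrr add0r.
exact: cvgB (cvgD xi ri) x1i.
Qed.

(** Both squared distances converge along [\oo], and their difference is affine in [x n], so
    [Q (x n) (z - z')] converges too. Its limits along [W] and [W'] therefore agree, which gives
    [Q (z - z') (z - z') = 0]. *)
Lemma ultra_lim_unique (W W' : set_system nat) z z' :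
  UltraFilter W -> \oo `<=` W -> UltraFilter W' -> \oo `<=` W' ->
  (forall v, dotl2 (x n) v @[n --> W] --> dotl2 z v) ->
  (forall v, dotl2 (x n) v @[n --> W'] --> dotl2 z' v) -> z = z'.
Proof.
move=> UW oW UW' oW' zP zP'.
have [l lP] := fejer_cvg (ultra_stationary UW oW zP).
have [l' lP'] := fejer_cvg (ultra_stationary UW' oW' zP').
pose y := z - z'.
have yP : Q (x n) y @[n --> \oo] --> (l' - l + Q z z - Q z' z') / 2.
  have -> : (fun n => Q (x n) y) = (fun n => (Q (x n - z') (x n - z') - Q (x n - z) (x n - z)
      + Q z z - Q z' z') / 2).
    by apply/funext => n; rewrite /Q !defect_formB /y defect_formBr; field.
  apply: cvgMl; apply: cvgB; last exact: cvg_cst.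
  by apply: cvgD; [exact: cvgB | exact: cvg_cst].
have Qlim (V : set_system nat) t : (forall v, dotl2 (x n) v @[n --> V] --> dotl2 t v) ->
    Q (x n) y @[n --> V] --> Q t y.
  move=> h; rewrite /Q (defect_form_adjoint q0 Tq).
  under eq_fun do rewrite (defect_form_adjoint q0 Tq).
  exact: h.
have e1 := cvgR_unique (PF := @ultra_proper _ _ UW) (Qlim _ _ zP) (cvg_trans (cvg_app _ oW) yP).
have e2 := cvgR_unique (PF := @ultra_proper _ _ UW') (Qlim _ _ zP') (cvg_trans (cvg_app _ oW') yP).
have Qy : Q y y = 0.
  by rewrite /Q {1}/y defect_formBl -/(Q z y) -/(Q z' y) e1 e2 subrr.
have y0 : dotl2 y y <= 0.
  have := defect_form_ge Tq y; rewrite -/(Q y y) Qy.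
  by rewrite pmulr_rle0//; move: q1; lra.
by apply/eqP; rewrite -subr_eq0; apply/eqP; exact: dotuu_eq0.
Qed.

Theorem opial : exists z, weak_cvg x z /\ stationary z.
Proof.
have [W [UW ooW]] := @ultraFilterLemma nat \oo _.
have [z zP] := weak_ultra_lim UW xM.
exists z; split; last exact: ultra_stationary zP.
move=> v; apply: ultra_cvg => W' UW' ooW'.
have [z' zP'] := weak_ultra_lim UW' xM.
by rewrite (ultra_lim_unique UW ooW UW' ooW' zP zP').
Qed.

End opial.

(** * The thresholding iteration *)

Section real_arithmetic.
Variable R : realDomainType.
Implicit Types a b c l m q P : R.

Lemma surrogate_step_arith a w h m m' :
  (h - (a + w)) ^+ 2 + m <= (a - (a + w)) ^+ 2 + m' ->
  m + (h - a) * (h - a) <= m' + 2 * ((h - a) * w).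
Proof. by nra. Qed.

Lemma descent_arith q a b c P P' z : b <= q * a -> P + a <= P' + 2 * - c ->
  z + c + (c + b) + P + (1 - q) * a <= z + P'.
Proof. by move=> h1 h2; nra. Qed.

Lemma gap_arith a b c l m : m < l -> c < l - m ->
  a <= m \/ l < a -> b <= m \/ l < b -> a - b <= c -> b - a <= c ->
  (l < a) = (l < b).
Proof.
by move=> ml cl [ha|ha] [hb|hb] ab ba; apply/idP/idP => h //; lra.
Qed.

Lemma sum_double_le a b c : a <= c -> b <= c -> 2 * a + 2 * b <= 4 * c.
Proof. by move=> ac bc; lra. Qed.

End real_arithmetic.

Section iteration.
Variables (R : realType) (I K : countType) (T : {linear ell2 R I -> ell2 R K}).
Variables (g : ell2 R K) (p r q : R).
Hypotheses (p1 : 1 <= p) (r0 : 0 < r) (pr : p = 1 -> 1 / 4 <= r).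
Hypotheses (q0 : 0 <= q) (q1 : q < 1).
Hypothesis Tq : forall u, dotl2 (T u) (T u) <= q * dotl2 u u.
Implicit Types u v : ell2 R I.

Let H := Hmap r T g p1.
Let t := lower_level p r.
Let lam := lambda' r p.

Definition finite_penalty v : Prop := rsummable (fun i => trunc_pow p r (v i)).

Definition penalty v : R := rsum (fun i => trunc_pow p r (v i)).

(** The real-valued counterpart of [Jpr]; the two agree under [finite_penalty], while [fine] sends
    an infinite sum to 0. *)
Definition energy v : R := dotl2 (T v - g) (T v - g) + penalty v.

Lemma penalty_ge0 v : 0 <= penalty v.
Proof. by apply: rsum_ge0 => i; exact: trunc_pow_ge0. Qed.

Lemma energy_ge0 v : 0 <= energy v.
Proof. exact: (addr_ge0 (dotuu_ge0 _) (penalty_ge0 _)). Qed.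

Lemma Hmap_coord v i : H v i = Hthr p r (v i + residual T g v i).
Proof. by rewrite -(landweberE q0 Tq). Qed.

(* [H v] minimises the surrogate [J u + |u - v|^2 - |T (u - v)|^2] coordinatewise. *)
Lemma Hmap_penalty v : finite_penalty v -> finite_penalty (H v) /\
  penalty (H v) + dotl2 (H v - v) (H v - v)
    <= penalty v + 2 * dotl2 (H v - v) (residual T g v).
Proof.
move=> sv; pose w := residual T g v; pose d := H v - v.
have pt i : trunc_pow p r (H v i) + d i * d i
    <= trunc_pow p r (v i) + 2 * (d i * w i).
  by rewrite /d ell2B Hmap_coord; apply: surrogate_step_arith; exact: Hthr_min.
have sdw : rsummable (fun i => 2 * (d i * w i)).
  by apply: rsummableZ; exact: dot_summable.
have sH : finite_penalty (H v).
  apply: rsummable_le (rsummableD sv sdw) => i.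
  rewrite ger0_norm ?trunc_pow_ge0//; apply: le_trans (pt i).
  by rewrite lerDl -expr2 sqr_ge0.
split => //.
have := ler_rsum (rsummableD sH (dot_summable d d)) (rsummableD sv sdw) pt.
rewrite (rsumD sH (dot_summable d d)) (rsumD sv sdw) rsumZ//.
exact: dot_summable.
Qed.

(** With [d = H v - v], the surrogate inequality treats the quadratic term to first order; the
    remainder [dotl2 (T d) (T d)] is at most [q * dotl2 d d]. *)
Lemma energy_descent v : finite_penalty v ->
  energy (H v) + (1 - q) * dotl2 (H v - v) (H v - v) <= energy v.
Proof.
move=> /Hmap_penalty[_]; rewrite (dot_residual q0 Tq); set d := H v - v.
have := Tq d; rewrite /energy.
have -> : T (H v) - g = (T v - g) + T d.
  by rewrite /d (linearB T) addrCA addrAC subrr add0r addrC.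
have -> : g - T v = - (T v - g) by rewrite opprB.
move: (T v - g) => z; rewrite !(dotDl, dotDr, dotNr) (dotC z (T d)).
exact: descent_arith.
Qed.

Lemma iter_finite_penalty n v : finite_penalty v -> finite_penalty (iter n H v).
Proof.
by move=> sv; elim: n => [|n ih]; [exact: sv | have [] := Hmap_penalty ih].
Qed.

Lemma energy_iter_le v n : finite_penalty v -> energy (iter n.+1 H v) <= energy (iter n H v).
Proof.
move=> sv; apply: le_trans (energy_descent (iter_finite_penalty n sv)).
by rewrite lerDl mulr_ge0 ?dotuu_ge0// subr_ge0 ltW.
Qed.

Lemma energy_iter_le0 v n : finite_penalty v -> energy (iter n H v) <= energy v.
Proof.
move=> sv; elim: n => [|n ih]; first exact: lexx.
exact: le_trans (energy_iter_le n sv) ih.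
Qed.

(** The energies decrease and are nonnegative, so their decrements, which dominate the squared
    steps, tend to 0. *)
Lemma iter_regular v : finite_penalty v ->
  dotl2 (iter n.+1 H v - iter n H v) (iter n.+1 H v - iter n H v)
    @[n --> \oo] --> (0 : R).
Proof.
move=> sv; pose e n := energy (iter n H v).
have : cvgn e.
  apply: nonincreasing_is_cvgn.
    by apply/nonincreasing_seqP => n; exact: energy_iter_le.
  by exists 0 => _ [n _ <-]; exact: energy_ge0.
move=> /cvg_ex[l el].
have el1 : e n.+1 @[n --> \oo] --> l by rewrite (cvg_shiftS e).
have q1' : 0 < 1 - q by rewrite subr_gt0.
apply: (@squeeze_cvgr _ _ _ _ (fun=> 0) (fun n => (1 - q)^-1 * (e n - e n.+1))).
- apply: filterS filterT => n _; rewrite dotuu_ge0 /= ler_pdivlMl//.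
  by rewrite lerBrDl; exact: (energy_descent (iter_finite_penalty n sv)).
- exact: cvg_cst.
- rewrite -[X in _ --> X](mulr0 (1 - q)^-1) -(subrr l).
  exact: cvgMr (cvgB el el1).
Qed.

Lemma lower_lt_lambda' : t < lam.
Proof. by have [_ tr rl] := lower_level_bounds p1 r0 pr; exact: le_lt_trans rl. Qed.

Lemma Hmap_dichotomy v i : `|H v i| <= t \/ lam < `|H v i|.
Proof.
rewrite Hmap_coord.
by have [[_ [h _ _]]|[h [-> _]]] := Hthr_cases p1 r0 pr (v i + residual T g v i); [left|right].
Qed.

Definition split_at (s : seq I) v := forall i,
  (i \in s -> lam < `|v i|) /\ (i \notin s -> `|v i| <= t).

(* The values of [H] avoid the gap between [t] and [lam], which the iterates are
   eventually too slow to jump over. *)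
Lemma split_stable v : finite_penalty v ->
  exists N s, uniq s /\ forall n, split_at s (iter n H (iter N H v)).
Proof.
move=> sv; have tl := lower_lt_lambda'.
have c0 : 0 < (lam - t) ^+ 2 by rewrite exprn_gt0// subr_gt0.
have /cvgrPdist_lt /(_ _ c0) [N _ hN] := iter_regular sv.
(* Starting at [N.+1] makes [x 0] itself a value of [H], so that the dichotomy holds for every
   [x n]. *)
pose x n := iter n H (iter N.+1 H v).
have xE n : x n = H (iter (n + N) H v) by rewrite /x -iterD addnS.
have small n i : `|x n.+1 i - x n i| < lam - t.
  rewrite -(@ltr_pXn2r _ 2)// ?nnegrE ?subr_ge0 ?ltW// real_normK ?num_real//.
  rewrite -ell2B; apply: le_lt_trans (sq_le_dot _ _) _.
  have := hN (n + N).+1; rewrite /= sub0r normrN ger0_norm ?dotuu_ge0// !xE; apply.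
  by rewrite -addSn leq_addl.
have keep n i : (lam < `|x n.+1 i|) = (lam < `|x n i|).
  have d1 := Hmap_dichotomy (iter (n + N) H v) i.
  have d2 := Hmap_dichotomy (iter (n.+1 + N) H v) i.
  rewrite -!xE in d1 d2; have sm := small n i.
  apply: (gap_arith tl sm d2 d1); first exact: lerB_dist.
  by rewrite distrC; exact: lerB_dist.
have lam0 : 0 < lam by have [h1 h2 h3] := lower_level_bounds p1 r0 pr; exact: lt_trans h3.
(* Square summability leaves only finitely many coordinates of modulus at least [lam > 0]. *)
have [s0 us0 hs0] := ell2_large_finite (x 0%N) (exprn_gt0 2 lam0).
exists N.+1, [seq i <- s0 | lam < `|x 0%N i|]; split; first exact: filter_uniq.
move=> n i; rewrite -/(x n) mem_filter.
have xn : (lam < `|x n i|) = (lam < `|x 0%N i|) by elim: n => [|n <-]; [exact: erefl | exact: keep].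
have [h|h] := boolP (lam < `|x 0%N i|); rewrite /= -xn in h *; last first.
  split=> // _; have := Hmap_dichotomy (iter (n + N) H v) i; rewrite -xE => -[//|h'].
  by rewrite h' in h.
split=> // is0; have := hs0 _ is0; rewrite -(real_normK (num_real _)).
rewrite ltr_pXn2r ?nnegrE ?(ltW lam0)// => h'.
by move: h; rewrite xn => /(lt_trans h'); rewrite ltxx.
Qed.

(** The size of the new coordinate reveals which branch of the thresholding function produced it. *)
Lemma split_step s v i : split_at s (H v) ->
  (i \in s -> H v i = v i + residual T g v i) /\
  (i \notin s -> half_subgrad p (H v i) (v i + residual T g v i - H v i)).
Proof.
move=> /(_ i)[h1 h2]; have tl := lower_lt_lambda'.
have := Hthr_cases p1 r0 pr (v i + residual T g v i); rewrite -Hmap_coord.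
move=> [[_ [ht hs _]]|[hl [he _]]]; split => is_.
- by have := lt_le_trans (lt_trans tl (h1 is_)) ht; rewrite ltxx.
- exact: hs.
- exact: he.
- by rewrite -he in hl; have := lt_le_trans (lt_trans tl hl) (h2 is_); rewrite ltxx.
Qed.

Hypothesis pI : p <= 2 \/ finite_set [set: I].

(** Here [pI] enters. If [p <= 2], a coordinate of modulus at most [r] satisfies
    [|v i| ^ 2 <= r ^ (2 - p) * |v i| ^ p]; if the index set is finite, each such coordinate
    contributes at most [r ^ 2]. *)
Lemma low_part_bound : exists2 C : R, 0 <= C &
  forall v y : ell2 R I, finite_penalty v ->
    (forall i, y i = 0 \/ (y i = v i /\ `|v i| <= r)) ->
    dotl2 y y <= C * (1 + penalty v).
Proof.
have p0 : 0 < p by exact: lt_le_trans p1.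
case: pI => [p2|/finite_seqP[s0 sE]].
  exists (r `^ (2 - p)) => [|v y sv hy]; first exact: powR_ge0.
  apply: (@le_trans _ _ (r `^ (2 - p) * penalty v)); last first.
    by rewrite ler_wpM2l ?powR_ge0// lerDr.
  rewrite /penalty -rsumZ//; apply: ler_rsum; [exact: dot_summable|exact: rsummableZ|].
  move=> i; have [->|[-> vr]] := hy i.
    by rewrite mulr0 mulr_ge0 ?powR_ge0 ?trunc_pow_ge0.
  rewrite /trunc_pow min_l; last first.
    by apply: ge0_ler_powR; rewrite ?nnegrE ?(ltW p0) ?(ltW r0).
  rewrite -expr2 -(real_normK (num_real _)) -powR_mulrn//.
  rewrite [X in _ `^ X <= _](_ : 2%:R = (2 - p) + p); last by rewrite subrK.
  rewrite powRD; last by rewrite subrK pnatr_eq0.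
  rewrite ler_wpM2r ?powR_ge0//; apply: ge0_ler_powR; rewrite ?nnegrE ?(ltW r0)//.
  by rewrite subr_ge0.
exists ((size (undup s0))%:R * r ^+ 2) => [|v y sv hy].
  by rewrite mulr_ge0 ?ler0n ?sqr_ge0.
set s := undup s0.
have ys i : i \notin s -> y i = 0.
  move=> h; suff : i \in s by rewrite (negbTE h).
  by rewrite mem_undup; have : [set: I] i by []; rewrite sE.
rewrite (@dot_supp _ _ s y y (undup_uniq _) ys).
apply: (@le_trans _ _ ((size s)%:R * r ^+ 2)); last first.
  apply: ler_peMr; last by rewrite lerDl penalty_ge0.
  by rewrite mulr_ge0 ?ler0n ?sqr_ge0.
elim: (s) => [|i a ih]; first by rewrite big_nil mul0r.
rewrite big_cons /= -natr1 mulrDl mul1r [leRHS]addrC lerD//.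
have [->|[-> vr]] := hy i; first by rewrite mulr0 sqr_ge0.
by rewrite -expr2 -(real_normK (num_real _)) lerXn2r ?nnegrE ?(ltW r0).
Qed.

Lemma iter_bounded s v : finite_penalty v -> uniq s ->
  (forall n, split_at s (iter n H v)) ->
  exists M : R, forall n, dotl2 (iter n H v) (iter n H v) <= M.
Proof.
move=> sv us hs; pose x n := iter n H v.
(* [X] is the large part, [y] the small part, and [d] the displacement of the large part, to which
   coercivity applies. *)
pose X n := fproj s (x n); pose y n := x n - X n; pose d n := X n - X 0%N.
have [tr rl] : t <= r /\ r < lam by have [_] := lower_level_bounds p1 r0 pr.
have [C C0 hC] := low_part_bound.
have yC n : dotl2 (y n) (y n) <= C * (1 + energy v).
  apply: (@le_trans _ _ (C * (1 + penalty (x n)))).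
    apply: hC; first exact: iter_finite_penalty.
    move=> i; rewrite /y ell2B /X; have [is_|is_] := boolP (i \in s).
      by left; rewrite fprojE// subrr.
    by right; rewrite fproj_out// subr0; split=> //; apply: le_trans tr; exact: (hs n i).2.
  rewrite ler_wpM2l// lerD2l; apply: le_trans (energy_iter_le0 n sv).
  by rewrite lerDr dotuu_ge0.
have [B B0 hB] := finite_support_coercive q0 Tq us.
have Xs n i : i \notin s -> X n i = 0 by exact: fproj_out.
(* On [s] the iteration moves only within the range of the adjoint. *)
have Xk n (k : ell2 R I) : (forall i, i \notin s -> k i = 0) -> T k = 0 ->
    dotl2 (X n) k = dotl2 (X 0%N) k.
  move=> ks Tk.
  have XE m : dotl2 (X m) k = dotl2 (x m) k.
    rewrite (dot_supp _ us ks) [RHS](dot_supp _ us ks).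
    by apply: eq_big_seq => i si; rewrite /X fprojE.
  rewrite !XE; elim: n => [|n <-]; first exact: erefl.
  rewrite (dot_supp _ us ks) (eq_big_seq (fun i => (x n + residual T g (x n)) i * k i)).
    rewrite -(dot_supp _ us ks) dotDl (dotC (residual _ _ _)) (dot_residual q0 Tq).
    by rewrite Tk dot0l addr0.
  move=> i si; cbv beta; congr (_ * _).
  exact: (@split_step s (x n) i (hs n.+1)).1.
have dB n : dotl2 (d n) (d n) <= B * dotl2 (T (d n)) (T (d n)).
  apply: hB => [i si|k ks Tk]; first by rewrite /d ell2B !Xs// subrr.
  by rewrite /d dotBl Xk// subrr.
pose E := energy v; pose D := C * (1 + E).
(* [T (d n)] is a difference of two data misfits, bounded by the energy, minus the image of a
   difference of two small parts. *)
have Td n : dotl2 (T (d n)) (T (d n)) <= 2 * (4 * E) + 2 * (q * (4 * D)).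
  have -> : T (d n) = ((T (x n) - g) - (T (x 0%N) - g)) - T (y n - y 0%N).
    rewrite /d /y !(linearB T) [in RHS]opprB; apply: ell2P => i.
    by rewrite !(ell2B, ell2D); ring.
  have tE m : dotl2 (T (x m) - g) (T (x m) - g) <= E.
    by apply: le_trans (energy_iter_le0 m sv); rewrite lerDl penalty_ge0.
  apply: le_trans (sq_dotB_le _ _) _; rewrite lerD// ler_pM2l//.
    apply: le_trans (sq_dotB_le _ _) _.
    exact: sum_double_le.
  apply: le_trans (Tq _) _; rewrite ler_wpM2l//.
  apply: le_trans (sq_dotB_le _ _) _.
  exact: sum_double_le.
exists (2 * (B * (2 * (4 * E) + 2 * (q * (4 * D)))) +
        2 * (2 * D + 2 * dotl2 (- X 0%N) (- X 0%N))) => n.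
have -> : iter n H v = d n - (- X 0%N - y n).
  by rewrite -/(x n); apply: ell2P => i; rewrite /d /y !(ell2B, ell2N); ring.
apply: le_trans (sq_dotB_le _ _) _; rewrite lerD// ler_pM2l//.
  by apply: le_trans (dB n) _; rewrite ler_wpM2l.
apply: le_trans (sq_dotB_le _ _) _; rewrite addrC lerD2r ler_pM2l//.
Qed.

End iteration.

(** * Assembling the convergence theorem and its fixed point condition *)

Lemma finite_Jpr_penalty (R : realType) (I K : countType)
    (T : {linear ell2 R I -> ell2 R K}) (g : ell2 R K) (p r : R) (u : ell2 R I) :
  (Jpr p r T g u < +oo)%E -> finite_penalty p r u.
Proof.
move=> Ju; apply/rsummable_ge0P => [i|]; first exact: trunc_pow_ge0.
by apply: le_lt_trans Ju; rewrite /Jpr leeDr// lee_fin sqr_ge0.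
Qed.

Theorem theorem3p9 (R : realType) (I K : countType)
    (T : {linear ell2 R I -> ell2 R K}) (g : ell2 R K) (r p : R)
    (hT : (opnorm T < 1)%E)
    (hr : 0 < r)
    (hp1 : 1 <= p)
    (hp2 : p <= 2 \/ finite_set [set: I])
    (hpr : p = 1 -> 1 / 4 <= r)
    (u0 : ell2 R I)
    (hu0 : (Jpr p r T g u0 < +oo)%E) :
  exists ubar : ell2 R I,
    weak_cvg (fun n => iter n (Hmap r T g hp1) u0) ubar /\
    (forall i, r < `|ubar i| -> lambda' r p <= `|ubar i|) /\
    (1 < p -> forall i, `|ubar i| <= r -> `|ubar i| <= Fpinv p (lambda' r p)) /\
    (1 < p -> forall i,
       (lambda' r p <= `|ubar i| -> adjoint T (g - T ubar) i = 0) /\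
       (`|ubar i| <= lambda' r p - jump r p ->
          adjoint T (g - T ubar) i = Fp p (ubar i) - ubar i)) /\
    (p = 1 -> forall i,
       (`|ubar i| <= 1 / 2 ->
          - (1 / 2) <= adjoint T (g - T ubar) i <= 1 / 2) /\
       (1 / 2 < `|ubar i| <= r - 1 / 4 ->
          adjoint T (g - T ubar) i = 1 / 2 * Num.sg (ubar i)) /\
       (r + 1 / 4 < `|ubar i| -> adjoint T (g - T ubar) i = 0)).
Proof.
have [q [q0 q1 Tq]] := opnorm_lt1 hT.
have su0 := finite_Jpr_penalty hu0.
have [N [s [us hs]]] := split_stable g hp1 hr hpr q0 q1 Tq su0.
set H := Hmap r T g hp1 in hs *; set v := iter N H u0 in hs.
have sv : finite_penalty p r v by exact: (iter_finite_penalty g hp1 hr hpr q0 Tq).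
have [M hM] := iter_bounded hr hpr q0 q1 Tq hp2 sv us hs.
(* On [s] the truncated penalty has its constant value, so its derivative is zero; off [s] it is the
   untruncated convex power. *)
pose G i (a b : R) := if i \in s then b = 0 else half_subgrad p a b.
have Gmono i a b a' b' : G i a b -> G i a' b' -> 0 <= (a - a') * (b - b').
  rewrite /G; case: ifP => _; last exact: half_subgrad_mono.
  by move=> -> ->; rewrite subrr mulr0.
have Gclosed i (W : set_system nat) (a b : nat -> R) (x y : R) :
    ProperFilter W -> a n @[n --> W] --> x -> b n @[n --> W] --> y ->
    (forall n, G i (a n) (b n)) -> G i x y.
  move=> PW ax bY; rewrite /G; case: ifP => _ hG; last first.
    by have [c hc] := half_subgrad_ex hp1 x; exact: half_subgrad_closed hc ax bY hG.
  apply: (cvgR_unique bY).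
  by under eq_fun do rewrite hG; exact: cvg_cst.
have xG n i : G i (iter n.+1 H v i)
    (iter n H v i + residual T g (iter n H v) i - iter n.+1 H v i).
  have [h1 h2] := split_step hr hpr q0 Tq i (hs n.+1).
  by rewrite /G; case: ifPn => is_; [rewrite [X in _ - X]h1// subrr | exact: h2].
have xreg := iter_regular g hp1 hr hpr q0 q1 Tq sv.
have [z [zw zG]] := opial q0 q1 Tq Gmono Gclosed hM xreg xG.
have zi i : iter n H v i @[n --> \oo] --> z i.
  have := zw (basis R i); rewrite dot_basis.
  by under eq_fun do rewrite dot_basis.
(* The strict bound on the iterates becomes a weak one in the limit. *)
have zhigh i : i \in s -> lambda' r p <= `|z i|.
  move=> is_; apply: (cvgr_to_ge (cvg_norm (zi i))).
  by apply: nearW => n; apply: ltW; exact: (hs n i).1.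
have zlow i : i \notin s -> `|z i| <= lower_level p r.
  move=> is_; apply: (cvgr_to_le (cvg_norm (zi i))).
  by apply: nearW => n; exact: (hs n i).2.
have [t0 tr rl] := lower_level_bounds hp1 hr hpr.
(* Since [lower_level <= r < lambda'], comparing the limit coordinate with [r] decides membership in
   [s]. *)
have high i : r < `|z i| -> i \in s.
  by move=> ri; apply: contraTT ri => /zlow zl; rewrite -leNgt (le_trans zl).
have low i : `|z i| <= r -> i \notin s.
  by move=> ri; apply: contraTN ri => /zhigh zl; rewrite -ltNge (lt_le_trans rl).
have Ghigh i : r < `|z i| -> adjoint T (g - T z) i = 0.
  by move=> /high is_; have := zG i; rewrite /G is_.
have Glow i : `|z i| <= r -> half_subgrad p (z i) (adjoint T (g - T z) i).
  by move=> /low /negbTE is_; have := zG i; rewrite /G is_.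
exists z; split=> [w|].
  rewrite -(cvg_shiftn N); under eq_fun do rewrite /= iterD.
  exact: zw.
split=> [i /high|]; first exact: zhigh.
split=> [p1 i /low /zlow|]; first by rewrite /lower_level gt_eqF.
split=> [p1 i|pe i].
  split=> [li|]; first by apply: Ghigh; exact: lt_le_trans li.
  rewrite lambda'_subr_jump ?gt_eqF// => /le_trans /(_ tr) /Glow.
  exact: (half_subgradE p1).
split=> [_|].
  (* When [r < 1 / 2] the coordinate may exceed [r]; its residual is then 0, which also lies in the
     interval. *)
  have [/Glow|/Ghigh ->] := leP `|z i| r; last by rewrite oppr_le0 divr_ge0.
  by rewrite pe => /half_subgrad1P[-> ->].
split=> [/andP[z2 zr]|zr]; last by apply: Ghigh; rewrite (lt_trans _ zr)// ltrDl divr_gt0.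
have zr' : `|z i| <= r by rewrite (le_trans zr)// gerBl divr_ge0.
have := Glow _ zr'; rewrite pe => /half_subgrad1P[_ _]; apply.
by rewrite -normr_gt0 (lt_trans _ z2)// divr_gt0.
Qed.
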